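(* Let $\mathbf{k}$ be an algebraically closed field of characteristic $0$ and let $X$ be a (not necessarily smooth) projective curve over $\mathbf{k}$. Let $L$ be a very ample line bundle on $X$ such that the divisor class of $L$ is a multiple of a smooth point $p\in X$. Then the algebra of sections $R=R(X,L)=\bigoplus_{i\ge 0}H^0(X,L^{\otimes i})$ has a finite Khovanskii basis with respect to the valuation $\mathfrak{v}_p$, i.e. the value semigroup $S(R,\mathfrak{v}_p)$ is finitely generated.
   Context: Curves are irreducible and reduced (varieties). For a smooth point $p\in X$, the homogeneous valuation $\mathfrak{v}_p:R\setminus\{0\}\to\mathbb{Z}_{\ge 0}\times\mathbb{Z}$ is $\mathfrak{v}_p(f)=(\deg(f),\mathrm{ord}_p(f))$ for homogeneous $f\ne0$ (where $\mathrm{ord}_p$ is the order of vanishing at $p$ of a section of $L^{\otimes \deg f}$), extended to all nonzero $f=\sum_i f_i$ by $\mathfrak{v}_p(f)=\min\{\mathfrak{v}_p(f_i)\mid f_i\neq0\}$, where $\mathbb{Z}_{\ge0}\times\mathbb{Z}$ is ordered lexicographically and the first factor carries the reverse of the usual ordering. The value semigroup is $S(R,\mathfrak{v}_p)=\mathfrak{v}_p(R\setminus\{0\})$. A Khovanskii basis for $(R,\mathfrak{v})$ is a subset of $R$ whose image in $\mathrm{gr}_{\mathfrak{v}}(R)=\bigoplus_a R_{\mathfrak{v}\ge a}/R_{\mathfrak{v}>a}$ generates it as an algebra, where $R_{\mathfrak{v}\ge a}=\{f\mid f=0\text{ or }\mathfrak{v}(f)\ge a\}$ and similarly for $>$. 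*)

(* Defs.v *)
From HB Require Import structures.
From mathcomp Require Import all_boot all_order all_algebra.
From mathcomp Require Import ring_quotient generic_quotient fraction.
From mathcomp Require Import boolp.
From mathcomp.multinomials Require Import mpoly.

Set Implicit Arguments.
Unset Strict Implicit.
Unset Printing Implicit Defensive.

Import GRing.Theory.
Local Open Scope ring_scope.

(* The ring R / I for a prime ideal I.  The library gives the quotient its
   commutative ring structure; the partial inverse needed for {fraction _} to
   make sense is chosen classically. *)
Definition coord_ring (R : comNzRingType) (I : prime_idealr R) : Type :=
  {ideal_quot I}.

Section CoordRing.
Variables (R : comNzRingType) (I : prime_idealr R).
Local Notation A := (coord_ring I).

HB.instance Definition _ := GRing.ComNzRing.on A.
HB.instance Definition _ := EqQuotient.on A.

Definition coord_unit : pred A := fun a => `[< exists b : A, b * a == 1 >].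

Definition coord_inv (a : A) : A :=
  match pselect (exists b : A, b * a == 1) with
  | left ab => xchoose ab
  | right _ => a
  end.

Fact coord_mulVr : {in coord_unit, left_inverse 1 coord_inv *%R}.
Proof.
move=> a /asboolP ua; rewrite /coord_inv; case: pselect => // ub.
exact/eqP/(xchooseP ub).
Qed.

Fact coord_unitP (a b : A) : b * a = 1 -> coord_unit a.
Proof. by move=> ba; apply/asboolP; exists b; rewrite ba. Qed.

Fact coord_inv_out : {in [predC coord_unit], coord_inv =1 id}.
Proof.
move=> a; rewrite inE /= => /asboolPn nua.
by rewrite /coord_inv; case: pselect.
Qed.

HB.instance Definition _ := GRing.ComNzRing_hasMulInverse.Build A
  coord_mulVr coord_unitP coord_inv_out.

Fact coord_idomain (a b : A) : a * b = 0 -> (a == 0) || (b == 0).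
Proof. exact: (@Quotient.rquot_IdomainAxiom _ I). Qed.

HB.instance Definition _ :=
  GRing.ComUnitRing_isIntegral.Build A coord_idomain.
End CoordRing.

Section ProjectiveSpace.
Variables (k : fieldType) (n : nat).
Local Notation S := {mpoly k[n.+1]}.

(* Points of P^n are nonzero vectors of homogeneous coordinates. *)
Definition same_point (x y : 'rV[k]_n.+1) : Prop :=
  exists2 c : k, c != 0 & y = c *: x.

Definition homogeneous_ideal (I : {pred S}) : Prop :=
  forall (F : S) (d : nat), F \in I -> pihomog mdeg d F \in I.

(* Irreducible closed subsets of P^n, i.e. points of the scheme Proj S. *)
Definition proj_prime (I : prime_idealr S) : Prop :=
  homogeneous_ideal (I : {pred S}) /\
  exists i : 'I_n.+1, 'X_i \notin (I : {pred S}).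

(* A chain Z_0 > Z_1 > ... > Z_r of irreducible closed subsets of V(I). *)
Definition has_chain (I : prime_idealr S) (r : nat) : Prop :=
  exists P : nat -> prime_idealr S,
    (forall i, (i <= r)%N ->
       proj_prime (P i) /\ {subset (I : {pred S}) <= (P i : {pred S})}) /\
    (forall i, (i < r)%N ->
       {subset (P i : {pred S}) <= (P i.+1 : {pred S})} /\
       exists2 F : S, F \in (P i.+1 : {pred S}) & F \notin (P i : {pred S})).

Definition proj_dim (I : prime_idealr S) (r : nat) : Prop :=
  has_chain I r /\ ~ has_chain I r.+1.

Definition projective_curve (I : prime_idealr S) : Prop :=
  proj_prime I /\ proj_dim I 1.

Definition set_of_forms (T : S -> Prop) : Prop :=
  forall F, T F -> exists d, F \is d.-homog.

Definition zero_of (T : S -> Prop) (x : 'rV[k]_n.+1) : Prop :=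
  x != 0 /\ forall F, T F -> F.@[x 0] = 0.
End ProjectiveSpace.

Section Variety.
Variables (k : fieldType) (n : nat) (I : prime_idealr {mpoly k[n.+1]}).
Local Notation S := {mpoly k[n.+1]}.
Local Notation K := {fraction (coord_ring I)}.

(* The closed points of X = V(I). *)
Definition on_X : 'rV[k]_n.+1 -> Prop := zero_of (fun F => F \in (I : {pred S})).

Definition cls (F : S) : K :=
  FracField.tofrac (\pi_(coord_ring I)%qT F : coord_ring I).
Definition cst (c : k) : K := cls c%:MP.

(* k(X) is the degree 0 part of K; O_(X,x) and its maximal ideal live in it. *)
Definition function_field (phi : K) : Prop :=
  exists (d : nat) (F G : S), [/\ F \is d.-homog, G \is d.-homog,
    G \notin (I : {pred S}) & phi = cls F / cls G].

Definition local_ring (x : 'rV[k]_n.+1) (phi : K) : Prop :=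
  exists (d : nat) (F G : S), [/\ F \is d.-homog, G \is d.-homog,
    G.@[x 0] != 0 & phi = cls F / cls G].

Definition local_ideal (x : 'rV[k]_n.+1) (phi : K) : Prop :=
  exists (d : nat) (F G : S), [/\ F \is d.-homog, G \is d.-homog,
    G.@[x 0] != 0, F.@[x 0] = 0 & phi = cls F / cls G].

Definition local_unit (x : 'rV[k]_n.+1) (phi : K) : Prop :=
  [/\ phi != 0, local_ring x phi & local_ring x phi^-1].

Definition uniformizer (x : 'rV[k]_n.+1) (u : K) : Prop :=
  local_ideal x u /\
  forall phi, local_ideal x phi -> exists2 psi, local_ring x psi & phi = psi * u.

(* X being a curve, O_(X,x) has dimension 1; it is a regular local ring when
   its maximal ideal is generated by one element.  Over an algebraically closed
   field, regular and smooth points coincide. *)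
Definition smooth_point (x : 'rV[k]_n.+1) : Prop :=
  on_X x /\ exists u, uniformizer x u.

Definition has_ord (x : 'rV[k]_n.+1) (phi : K) (j : int) : Prop :=
  exists2 u, uniformizer x u & local_unit x (phi / u ^ j).

(* X being integral, a line bundle L is an invertible subsheaf of the constant
   sheaf k(X).  It is given by a generator g x of each stalk L_x, such that
   near x the section g x generates L.  The stalk L_x is g x * O_(X,x). *)
Definition line_bundle (g : 'rV[k]_n.+1 -> K) : Prop :=
  (forall x, on_X x -> g x != 0 /\ function_field (g x)) /\
  (forall x, on_X x -> exists (d : nat) (H : S),
     [/\ H \is d.-homog, H.@[x 0] != 0 &
         forall y, on_X y -> H.@[y 0] != 0 -> local_unit y (g x / g y)]).

Definition tensor_power (g : 'rV[k]_n.+1 -> K) (i : nat) :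
  'rV[k]_n.+1 -> K := fun x => g x ^+ i.

Definition global_section (g : 'rV[k]_n.+1 -> K) (s : K) : Prop :=
  function_field s /\ forall x, on_X x -> local_ring x (s / g x).

(* An isomorphism of invertible subsheaves of k(X) is multiplication by some
   nonzero rational function. *)
Definition iso_bundle (g h : 'rV[k]_n.+1 -> K) : Prop :=
  exists phi : K, [/\ phi != 0, function_field phi &
    forall x, on_X x -> local_unit x (phi * g x / h x)].

(* h generates O_X(d p): its stalk at p consists of the functions of order at
   least - d, its other stalks are those of O_X. *)
Definition bundle_of_point (p : 'rV[k]_n.+1) (d : int)
    (h : 'rV[k]_n.+1 -> K) : Prop :=
  forall x, on_X x ->
    (same_point p x -> has_ord x (h x) (- d)) /\
    (~ same_point p x -> local_unit x (h x)).

Definition class_multiple_of_point (g : 'rV[k]_n.+1 -> K)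
    (p : 'rV[k]_n.+1) : Prop :=
  exists (d : int) (h : 'rV[k]_n.+1 -> K),
    bundle_of_point p d h /\ iso_bundle g h.

(* Sections s_0, ..., s_m generating L send x to the point z of P^m whose
   coordinates are the values at x of the functions s_j / g x. *)
Definition sections_map (g : 'rV[k]_n.+1 -> K) (m : nat) (s : 'I_m.+1 -> K)
    (x : 'rV[k]_n.+1) (z : 'rV[k]_m.+1) : Prop :=
  exists2 w : 'rV[k]_m.+1, same_point w z &
    forall j, local_ideal x (s j / g x - cst (w 0 j)).

(* L is very ample: it is generated by global sections s_0, ..., s_m whose
   associated morphism X -> P^m is a closed immersion, that is, injective,
   closed, and surjective from O_(P^m, z) to O_(X, x) whenever x maps to z. *)
Definition very_ample (g : 'rV[k]_n.+1 -> K) : Prop :=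
  exists (m : nat) (s : 'I_m.+1 -> K),
  [/\ (forall j, global_section g (s j)) /\
      (forall x, on_X x -> exists j, local_unit x (s j / g x)),
      (forall x y z, on_X x -> on_X y ->
         sections_map g s x z -> sections_map g s y z -> same_point x y),
      (forall T : S -> Prop, set_of_forms T ->
         exists2 T' : {mpoly k[m.+1]} -> Prop, set_of_forms T' &
         forall z, zero_of T' z <->
           exists x, [/\ on_X x, zero_of T x & sections_map g s x z]) &
      (forall x z psi, on_X x -> sections_map g s x z -> local_ring x psi ->
         exists (d : nat) (F G : {mpoly k[m.+1]}),
         [/\ F \is d.-homog, G \is d.-homog, G.@[z 0] != 0 &
             psi = mmap cst s F / mmap cst s G])].

(* R(X, L) as a subring of k(X)[t], the exponent of t being the degree. *)
Definition section_ring (g : 'rV[k]_n.+1 -> K) (f : {poly K}) : Prop :=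
  forall i : nat, global_section (tensor_power g i) f`_i.

(* Lexicographic order, with the usual order reversed on the first factor. *)
Definition val_le (a b : nat * int) : bool :=
  (b.1 < a.1)%N || ((a.1 == b.1) && (a.2 <= b.2)).
Definition val_lt (a b : nat * int) : bool := (a != b) && val_le a b.

Section Valuation.
Variables (g : 'rV[k]_n.+1 -> K) (p : 'rV[k]_n.+1).

Definition has_val_homog (i : nat) (s : K) (a : nat * int) : Prop :=
  a.1 = i /\ has_ord p (s / tensor_power g i p) a.2.

Definition has_val (f : {poly K}) (a : nat * int) : Prop :=
  (exists2 i : nat, f`_i != 0 & has_val_homog i f`_i a) /\
  (forall (i : nat) b, f`_i != 0 -> has_val_homog i f`_i b -> val_le a b).

Definition value_semigroup (a : nat * int) : Prop :=
  exists f : {poly K}, [/\ section_ring g f, f != 0 & has_val f a].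

Definition val_ge (a : nat * int) (f : {poly K}) : Prop :=
  section_ring g f /\ (f = 0 \/ exists2 b, has_val f b & val_le a b).
Definition val_gt (a : nat * int) (f : {poly K}) : Prop :=
  section_ring g f /\ (f = 0 \/ exists2 b, has_val f b & val_lt a b).

(* The associated graded algebra gr(R).  An element is written as a formal sum
   of terms (a, f), where (a, f) stands for the class of f in
   R_(v >= a) / R_(v > a); the equality of gr(R) is gr_eq. *)
Definition gr_elt := seq ((nat * int) * {poly K}).

Definition gr_wf (h : gr_elt) : Prop :=
  forall af, af \in h -> val_ge af.1 af.2.

Definition gr_comp (h : gr_elt) (a : nat * int) : {poly K} :=
  \sum_(af <- h | af.1 == a) af.2.

Definition gr_eq (h h' : gr_elt) : Prop :=
  forall a, val_gt a (gr_comp h a - gr_comp h' a).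

Definition gr_add (h h' : gr_elt) : gr_elt := h ++ h'.

Definition gr_mul (h h' : gr_elt) : gr_elt :=
  [seq (af.1 + bf.1, af.2 * bf.2) | af <- h, bf <- h'].

(* The k-subalgebra of gr(R) generated by the image of B; the image of a
   nonzero b is its class in degree v(b), and 0 is sent to 0. *)
Inductive gr_subalgebra (B : {poly K} -> Prop) : gr_elt -> Prop :=
| GrImage b a : B b -> has_val b a -> gr_subalgebra B [:: (a, b)]
| GrConst c : gr_subalgebra B [:: (0, (cst c)%:P)]
| GrAdd h h' : gr_subalgebra B h -> gr_subalgebra B h' ->
    gr_subalgebra B (gr_add h h')
| GrMul h h' : gr_subalgebra B h -> gr_subalgebra B h' ->
    gr_subalgebra B (gr_mul h h')
| GrEq h h' : gr_subalgebra B h -> gr_wf h' -> gr_eq h h' ->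
    gr_subalgebra B h'.

Definition khovanskii_basis (B : {poly K} -> Prop) : Prop :=
  (forall b, B b -> section_ring g b) /\
  (forall h, gr_wf h -> gr_subalgebra B h).
End Valuation.
End Variety.

(* The semigroup S, which contains 0, is generated by finitely many elements. *)
Definition finitely_generated (S : nat * int -> Prop) : Prop :=
  exists gs : seq (nat * int), forall a,
    S a <-> exists c : nat * int -> nat, a = \sum_(e <- gs) e *+ c e.

(* Main.v *)
Require Import Defs.
From HB Require Import structures.
From mathcomp Require Import all_boot all_order all_algebra.
From mathcomp Require Import ring_quotient generic_quotient fraction.
From mathcomp Require Import boolp ring zify.
From mathcomp Require classical_sets.
From mathcomp.multinomials Require Import mpoly.

(** Fix a uniformizer u at p, and call pole order any integer m for which some
    nonzero rational function, regular away from p, has order - m at p.  The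
    isomorphism between L and O(d p) turns a section of L^i whose order of
    vanishing at p is j into such a function with m = d i - j, and conversely.
    Hence the value semigroup consists of the pairs (i, j) with j >= 0 and
    d i - j in the monoid N of pole orders.

    Two facts of geometry make this useful.  First, N has no negative element:
    a function which is regular everywhere is constant, so it cannot vanish at
    p (regular_function_const).  This rests on the projective Nullstellensatz,
    and both have the same engine: an element of a field extension of k which
    stabilizes a nonzero finite-dimensional k-space is an eigenvalue of a
    matrix over k, hence lies in k (stable_span_scalar).  For the
    Nullstellensatz take, by Zorn, a homogeneous ideal M maximal among those
    not containing a power of the irrelevant ideal; it is prime, and if X_i is
    not in M then M + (X_i) contains all forms of some large degree D + 1, so
    that every X_j / X_i stabilizes the degree D part of the quotient, and is
    thus a constant: these constants are the coordinates of a zero of M.  For a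
    function a regular everywhere, the Nullstellensatz applied to its ideal of
    denominators shows that a stabilizes all forms of some degree.

    Secondly, every nonzero rational function has an order at p, that is,
    the intersection of the powers of u is zero in the local ring at p
    (krull_intersection).  Otherwise that intersection would give a prime
    strictly between the ideal of X and that of p, against the dimension of X.

    What remains is arithmetic, mainly for d > 0.  Once m is large, m in N
    implies m - c in N for c in N positive, because each residue class modulo c
    is eventually in N or out of N.  Take c = d e with e in N positive.  Then an
    element (i, j) of the semigroup with i large is decomposable: (1, d) can be
    subtracted when j >= d, and (e, 0) otherwise, as then d i - j is large.  So
    the elements with i bounded, finitely many, generate
    (section_semigroup_generated).

    Lifting these generators to homogeneous sections gives a Khovanskii basis,
    because the residue field at p is k: an element of R of value a is, up to
    terms of higher value, a scalar times any other element of value a, for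
    instance a monomial in the chosen sections (single_generated). *)

Set Implicit Arguments.
Unset Strict Implicit.
Unset Printing Implicit Defensive.
Import Order.TTheory GRing.Theory Num.Theory.
Local Open Scope ring_scope.

(** * The homogeneous coordinate ring inside its field of fractions *)

Section ClassMorphism.
Variables (k : fieldType) (n : nat) (I : prime_idealr {mpoly k[n.+1]}).
Local Notation S := {mpoly k[n.+1]}.
Local Notation K := {fraction (coord_ring I)}.
Local Notation pi := (\pi_(coord_ring I)%qT : S -> coord_ring I).

Fact coord_piB : {morph pi : F G / F - G}.
Proof.
move=> F G; apply: etrans (Quotient.pi_add I F (- G)) _.
by congr Quotient.add; exact: Quotient.pi_opp.
Qed.

Fact coord_piM : {morph pi : F G / F * G}.
Proof. by move=> F G; exact: (Quotient.pi_mul I F G). Qed.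

Fact coord_pi0 : pi 0 = 0.
Proof. by have := coord_piB 0 0; rewrite !subrr. Qed.

Fact coord_pi1 : pi 1 = 1.
Proof.
have e : \pi_(Quotient.quot I)%qT 1 = 1 :> Quotient.quot I by rewrite piE.
exact: e.
Qed.

Fact cls_is_zmod_morphism : zmod_morphism (cls I).
Proof. by move=> F G; rewrite /cls coord_piB rmorphB. Qed.

Fact cls_is_monoid_morphism : monoid_morphism (cls I).
Proof.
split; first by rewrite /cls coord_pi1 tofrac1.
by move=> F G; rewrite /cls coord_piM rmorphM.
Qed.

HB.instance Definition _ := GRing.isZmodMorphism.Build S K (cls I)
  cls_is_zmod_morphism.
HB.instance Definition _ := GRing.isMonoidMorphism.Build S K (cls I)
  cls_is_monoid_morphism.

Lemma cls_eq0 F : (cls I F == 0) = (F \in I).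
Proof.
rewrite /cls tofrac_eq0 -[F in RHS]subr0 Quotient.idealrBE.
by rewrite -[X in _ == X]coord_pi0.
Qed.
Fact cst_is_zmod_morphism : zmod_morphism (cst I).
Proof. by move=> a b; rewrite /cst mpolyCB rmorphB. Qed.

Fact cst_is_monoid_morphism : monoid_morphism (cst I).
Proof.
by split=> [|a b]; rewrite /cst ?mpolyCM ?rmorphM // mpolyC1 rmorph1.
Qed.

HB.instance Definition _ := GRing.isZmodMorphism.Build k K (cst I)
  cst_is_zmod_morphism.
HB.instance Definition _ := GRing.isMonoidMorphism.Build k K (cst I)
  cst_is_monoid_morphism.

Lemma clsZ c F : cls I (c *: F) = cst I c * cls I F.
Proof. by rewrite -mul_mpolyC rmorphM. Qed.

End ClassMorphism.

(** The coefficients M form a matrix of multiplication by a on the span of the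
    v t, so a is an eigenvalue of the image of that matrix under f; its
    characteristic polynomial already splits over k. *)
Lemma stable_span_scalar (k : closedFieldType) (K : fieldType)
    (f : {rmorphism k -> K}) (T : finType) (v : T -> K) (M : T -> T -> k)
    (a : K) (t0 : T) :
    v t0 != 0 -> (forall t, a * v t = \sum_t' f (M t t') * v t') ->
  exists c, a = f c.
Proof.
move=> nz_v av.
pose A := \matrix_(i < #|T|, j < #|T|) M (enum_val j) (enum_val i).
have: eigenvalue (map_mx f A) a.
  apply/eigenvalueP; exists (\row_j v (enum_val j)); last first.
    apply: contra_neq nz_v => /rowP/(_ (enum_rank t0)).
    by rewrite !mxE enum_rankK.
  apply/rowP => j; rewrite !mxE av (reindex (@enum_val T T)) /=; last first.
    by exists enum_rank => x _; rewrite ?enum_valK ?enum_rankK.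
  by apply: eq_bigr => i _; rewrite !mxE mulrC.
rewrite eigenvalue_root_char -map_char_poly.
have [s ->] := closed_field_poly_normal (char_poly A).
rewrite (monicP (char_poly_monic A)) scale1r rmorph_prod.
rewrite /root horner_prod prodf_seq_eq0 => /hasP[c _] /=.
rewrite rmorphB /= map_polyX map_polyC /= !hornerE subr_eq0 => /eqP ac.
by exists c.
Qed.

(** * Homogeneous components and homogeneous primes *)

Section HomogeneousComponents.
Variables (R : comNzRingType) (n : nat).
Implicit Types F G : {mpoly R[n]}.

Lemma pihomog_mul_homog e G d F : G \is e.-homog ->
  pihomog mdeg (d + e) (F * G) = pihomog mdeg d F * G.
Proof.
move=> homG; rewrite [F](pihomog_partitionE (leqnn (msize F))).
rewrite mulr_suml !linear_sum mulr_suml; apply: eq_bigr => j _ /=.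
have homFG := dhomogM (pihomogP mdeg j F) homG.
have [->|ne_jd] := eqVneq (j : nat) d.
  by rewrite pihomog_id pihomog_dE // dhomogM ?pihomogP.
rewrite (pihomog_ne0 _ homFG) ?eqn_add2r //.
by rewrite (pihomog_ne0 ne_jd (pihomogP _ _ _)) mul0r.
Qed.

Lemma pihomog_mul_homog_lt e G d F : G \is e.-homog -> (d < e)%N ->
  pihomog mdeg d (F * G) = 0.
Proof.
move=> homG lt_de; rewrite [F](pihomog_partitionE (leqnn (msize F))).
rewrite mulr_suml linear_sum big1 // => j _ /=.
apply: (pihomog_ne0 _ (dhomogM (pihomogP mdeg j F) homG)).
by apply: contraTneq lt_de => <-; rewrite -leqNgt leq_addl.
Qed.

Lemma pihomogM d F G :
  pihomog mdeg d (F * G) =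
    \sum_(j < d.+1) pihomog mdeg (d - j) F * pihomog mdeg j G.
Proof.
have pihomog_ge j : (msize G <= j)%N -> pihomog mdeg j G = 0.
  move=> le_Gj; rewrite pihomogE big_seq_cond big1 // => m /andP[mG /eqP mj].
  by move: (msize_mdeg_lt mG); rewrite mj ltnNge le_Gj.
rewrite {1}[G](pihomog_partitionE (mf := mdeg) (k := msize G + d.+1)) //;
  last exact: leq_addr.
rewrite mulr_sumr linear_sum /= -!(big_mkord predT (fun j =>
  pihomog mdeg d (F * pihomog mdeg j G))).
rewrite (big_cat_nat (leq0n d.+1)) ?leq_addl //= big_mkord.
rewrite [X in _ + X]big_nat [X in _ + X]big1 ?addr0 => [|j /andP[lt_dj _]].
  apply: eq_bigr => j _.
  have := pihomog_mul_homog (d - j) F (pihomogP mdeg j G).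
  by rewrite subnK ?leq_ord.
exact: (pihomog_mul_homog_lt _ (pihomogP _ _ _)).
Qed.

Lemma pihomog_convol_homog d (j : 'I_d.+1) F G :
  pihomog mdeg (d - j) F * pihomog mdeg j G \is d.-homog.
Proof.
have := dhomogM (pihomogP mdeg (d - j) F) (pihomogP mdeg j G).
by rewrite subnK ?leq_ord.
Qed.

End HomogeneousComponents.

Section HomogeneousPrimes.
Variables (k : fieldType) (n : nat).
Local Notation S := {mpoly k[n.+1]}.
Implicit Types F G : S.

(** A homogeneous ideal is determined by its forms; q d describes the forms of
    degree d.  The degree is an argument of q because a form and its degree are
    used together, as in the quotient of a form by a power of a coordinate. *)
Definition homogeneous_hull (q : nat -> S -> Prop) : {pred S} :=
  fun F => `[< forall d, q d (pihomog mdeg d F) >].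

Section Hull.
Variable q : nat -> S -> Prop.
Hypothesis q0 : forall d, q d 0.
Hypothesis qD : forall d F G, F \is d.-homog -> G \is d.-homog ->
  q d F -> q d G -> q d (F + G).
Hypothesis qM : forall d e F G, F \is d.-homog -> G \is e.-homog ->
  q d F -> q (d + e)%N (F * G).
Hypothesis q1 : ~ q 0 1.
Hypothesis q_prime : forall d e F G, F \is d.-homog -> G \is e.-homog ->
  q (d + e)%N (F * G) -> q d F \/ q e G.

Lemma homogeneous_hullP F :
  reflect (forall d, q d (pihomog mdeg d F)) (F \in homogeneous_hull q).
Proof. exact: asboolP. Qed.

Lemma homogeneous_hullE d F : F \is d.-homog ->
  F \in homogeneous_hull q <-> q d F.
Proof.
move=> homF; split=> [/homogeneous_hullP/(_ d)|qF]; first by rewrite pihomog_dE.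
apply/homogeneous_hullP => e; have [<-|ne_de] := eqVneq d e.
  by rewrite pihomog_dE.
by rewrite (pihomog_ne0 ne_de homF).
Qed.

Let q_sum (T : finType) (P : pred T) (d : nat) (F : T -> S) :
    (forall t, P t -> F t \is d.-homog /\ q d (F t)) ->
  q d (\sum_(t | P t) F t).
Proof.
move=> qF.
suff [] : \sum_(t | P t) F t \is d.-homog /\ q d (\sum_(t | P t) F t) by [].
elim/big_rec: _ => [|t F' /qF[homF qFt] [homF' qF']]; first by rewrite rpred0.
by split; [exact: rpredD | exact: qD].
Qed.

Let qB d F G : F \is d.-homog -> G \is d.-homog ->
  q d F -> q d G -> q d (F - G).
Proof.
move=> homF homG qF qG; apply: qD; rewrite ?rpredN //.
rewrite -[G]mulr1 -mulrN -[d]addn0; apply: qM => //.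
by rewrite rpredN dhomog1.
Qed.

Let q_convol d (j : 'I_d.+1) F G :
    q (d - j) (pihomog mdeg (d - j) F) \/ q j (pihomog mdeg j G) ->
  q d (pihomog mdeg (d - j) F * pihomog mdeg j G).
Proof.
have dE : (d - j + j)%N = d by rewrite subnK ?leq_ord.
case=> [qF|qG].
  by have := qM (pihomogP _ _ _) (pihomogP mdeg j G) qF; rewrite dE.
have := qM (pihomogP _ _ _) (pihomogP mdeg (d - j) F) qG.
by rewrite addnC dE mulrC.
Qed.

Fact homogeneous_hull_idealr : idealr_closed (homogeneous_hull q).
Proof.
split=> [||G F F' /homogeneous_hullP qF /homogeneous_hullP qF'].
- by apply/homogeneous_hullP => d; rewrite raddf0.
- by apply/negP => /(homogeneous_hullE (dhomog1 _ _)).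
apply/homogeneous_hullP => d; rewrite [G * F]mulrC linearD /= pihomogM.
apply: qD; rewrite ?pihomogP //.
  by apply: rpred_sum => j _; exact: pihomog_convol_homog.
apply: q_sum => j _; split; first exact: pihomog_convol_homog.
by apply: q_convol; left.
Qed.

(** Only forms have to be tested for primality: if F and G are not in the hull,
    the product of their highest components outside q is, modulo q, the
    component of F * G in that degree. *)
Fact homogeneous_hull_prime : prime_idealr_closed (homogeneous_hull q).
Proof.
move=> F G /homogeneous_hullP qFG; apply: contrapT => /negP.
rewrite negb_or => /andP[nqF nqG].
have top H : H \notin homogeneous_hull q ->
    exists2 d, ~ q d (pihomog mdeg d H) &
      forall e, (d < e)%N -> q e (pihomog mdeg e H).
  move=> /homogeneous_hullP /existsNP[d0 nqd0].
  have ubd e : ~~ `[< q e (pihomog mdeg e H) >] -> (e <= msize H)%N.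
    apply: contraR; rewrite -ltnNge => lt_He; apply/asboolP.
    suff -> : pihomog mdeg e H = 0 by exact: q0.
    rewrite pihomogE big_seq_cond big1 // => m /andP[mH /eqP me].
    by move: (msize_mdeg_lt mH); rewrite me ltnNge (ltnW lt_He).
  have exd : exists e, ~~ `[< q e (pihomog mdeg e H) >].
    by exists d0; apply/asboolPn.
  case: (ex_maxnP exd ubd) => d /asboolPn nqd maxd; exists d => // e.
  rewrite ltnNge => /(contraNN (maxd e)); rewrite negbK; exact: asboolP.
have [d nqd maxd] := top F nqF; have [e nqe maxe] := top G nqG.
have := qFG (d + e)%N; rewrite pihomogM.
have lt_e : (e < (d + e).+1)%N by rewrite ltnS leq_addl.
rewrite (bigD1 (Ordinal lt_e)) //= addnK => qde.
suff /(q_prime (pihomogP _ _ _) (pihomogP _ _ _))[] :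
  q (d + e)%N (pihomog mdeg d F * pihomog mdeg e G) by [].
set A := (X in X + _) in qde; set B := (X in _ + X) in qde.
have homA : A \is (d + e).-homog by rewrite dhomogM ?pihomogP.
have homB : B \is (d + e).-homog.
  by apply: rpred_sum => j _; exact: pihomog_convol_homog.
rewrite -/A -[A](addrK B); apply: qB => //; first exact: rpredD.
apply: q_sum => j ne_je; split; first exact: pihomog_convol_homog.
apply: q_convol; have [lt_je|lt_ej|eq_je] := ltngtP j e.
- by left; apply: maxd; rewrite ltn_subRL addnC ltn_add2l.
- by right; exact: maxe.
- by case/eqP: ne_je; apply: val_inj.
Qed.

HB.instance Definition _ := isIdealr.Build S (homogeneous_hull q)
  homogeneous_hull_idealr.
HB.instance Definition _ := isPrimeIdealrClosed.Build S (homogeneous_hull q)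
  homogeneous_hull_prime.

(** The three primes needed below are obtained in this way: the maximal ideals
    of the Nullstellensatz, the ideal of a point, and the ideal of the
    functions divisible by all powers of a uniformizer. *)
Lemma homogeneous_prime : exists P : prime_idealr S,
  homogeneous_ideal (P : {pred S}) /\
  forall d F, F \is d.-homog -> F \in (P : {pred S}) <-> q d F.
Proof.
exists (homogeneous_hull q : prime_idealr S); split; last first.
  by move=> d F homF; exact: homogeneous_hullE.
move=> F d /homogeneous_hullP qF.
by apply/(homogeneous_hullE (pihomogP _ _ _)).
Qed.

End Hull.

Lemma homogeneous_idealP (P : prime_idealr S) F :
    homogeneous_ideal (P : {pred S}) ->
  F \in (P : {pred S}) <-> forall d, pihomog mdeg d F \in (P : {pred S}).
Proof.
move=> homP; split=> [FP d|PF]; first exact: homP.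
by rewrite [F](pihomog_partitionE (leqnn (msize F))) rpred_sum.
Qed.

End HomogeneousPrimes.

(** * The projective Nullstellensatz *)

Section GradedIdeals.
Variables (k : fieldType) (n : nat).
Local Notation S := {mpoly k[n.+1]}.
Implicit Types (F G : S) (J : S -> Prop).

Definition graded_ideal J : Prop :=
  [/\ J 0, forall F G, J F -> J G -> J (F + G),
      forall F G, J F -> J (F * G) &
      forall d F, J F -> J (pihomog mdeg d F)].

(** For an ideal J, this says that J contains a power of the irrelevant ideal
    generated by the coordinates. *)
Definition irrelevant J : Prop := forall i, exists N, J ('X_i ^+ N).

(** Pigeonhole: a monomial of large degree is divisible by a large power of one
    of the coordinates. *)
Lemma irrelevant_monomials J : graded_ideal J -> irrelevant J ->
  exists N, forall m : 'X_{1..n.+1}, (N <= mdeg m)%N -> J 'X_[m].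
Proof.
move=> [_ _ JM _] /choice[e Je]; exists (\sum_i e i).+1 => m lt_em.
have [i le_ei] : exists i, (e i <= m i)%N.
  apply: contrapT => /forallNP lt_me; move: lt_em; rewrite mdegE ltnNge.
  by rewrite leq_sum // => i _; rewrite ltnW // ltnNge; exact/negP.
suff -> : 'X_[m] = 'X_i ^+ e i * 'X_[m - (U_(i) *+ e i)%MM] :> S by exact: JM.
rewrite mpolyXn -mpolyXD addmC submK //; apply/mnm_lepP => j.
by rewrite mulmnE mnm1E; case: eqP => [<-|_]; rewrite ?mul0n ?mul1n.
Qed.

(** Zorn applies because there are finitely many coordinates: if the union of a
    chain contains a power of each of them, so does a member of the chain. *)
Lemma graded_ideal_max J : graded_ideal J -> ~ irrelevant J ->
  exists M : S -> Prop, [/\ graded_ideal M, ~ irrelevant M,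
    forall F, J F -> M F &
    forall M' : S -> Prop, graded_ideal M' -> ~ irrelevant M' ->
      (forall F, M F -> M' F) -> forall F, M' F -> M F].
Proof.
move=> idJ irrJ.
pose T := {M : S -> Prop |
  [/\ graded_ideal M, ~ irrelevant M & forall F, J F -> M F]}.
pose sub (s t : T) := `[< forall F, sval s F -> sval t F >].
have subP s t : reflect (forall F, sval s F -> sval t F) (sub s t).
  exact: asboolP.
have J_T : [/\ graded_ideal J, ~ irrelevant J & forall F, J F -> J F] by [].
have sub_refl t : sub t t by apply/subP.
have sub_trans r s t : sub r s -> sub s t -> sub r t.
  by move=> /subP rs /subP st; apply/subP => F /rs/st.
have [A totA|m maxM] :=
    classical_sets.ZL_preorder (exist _ J J_T : T) sub_refl sub_trans.
  have [[s0 As0]|/forallNP A0] := pselect (exists s, A s); last first.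
    by exists (exist _ J J_T) => s /A0.
  pose U F := exists2 s, A s & sval s F.
  have U2 F G : U F -> U G -> exists s, [/\ A s, sval s F & sval s G].
    move=> [s As sF] [t At tG].
    have [/subP st|/subP ts] := totA s t As At.
      by exists t; split=> //; exact: st.
    by exists s; split=> //; exact: ts.
  have idU : graded_ideal U.
    split=> [|F G UF UG|F G [s As sF]|d F [s As sF]].
    - by exists s0 => //; case: (svalP s0) => -[].
    - have [s [As sF sG]] := U2 F G UF UG.
      by exists s => //; case: (svalP s) => -[_ sD _ _] _ _; exact: sD.
    - by exists s => //; case: (svalP s) => -[_ _ sM _] _ _; exact: sM.
    - by exists s => //; case: (svalP s) => -[_ _ _ sh] _ _; exact: sh.
  have irrU : ~ irrelevant U.
    move=> /choice[e Ue].
    have : forall l : seq 'I_n.+1, exists2 s, A s &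
        forall i, i \in l -> sval s ('X_i ^+ e i).
      elim=> [|i l [s As sl]]; first by exists s0.
      have [t At ti] := Ue i.
      have [/subP st|/subP ts] := totA s t As At.
        exists t => // j; rewrite inE => /orP[/eqP->//|/sl]; exact: st.
      exists s => // j; rewrite inE => /orP[/eqP->|/sl//]; exact: ts.
    move=> /(_ (enum 'I_n.+1))[s As sX]; case: (svalP s) => _ + _; apply.
    by move=> i; exists (e i); apply: sX; rewrite mem_enum.
  have JU F : J F -> U F.
    by move=> JF; exists s0 => //; case: (svalP s0) => _ _; exact.
  have U_T : [/\ graded_ideal U, ~ irrelevant U & forall F, J F -> U F] by [].
  by exists (exist _ U U_T) => s As; apply/subP => F sF; exists s.
have [idM irrM JM] := svalP m; exists (sval m); split=> // M' idM' irrM' MM'.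
have M'_T : [/\ graded_ideal M', ~ irrelevant M' & forall F, J F -> M' F].
  by split=> // F /JM/MM'.
pose t : T := exist _ M' M'_T; apply/(subP t m); apply: maxM.
exact/subP.
Qed.

Definition adjoin J F : S -> Prop :=
  fun H => exists2 A, J A & exists B, H = A + B * F.

Lemma graded_ideal_adjoin J d F : graded_ideal J -> F \is d.-homog ->
  graded_ideal (adjoin J F).
Proof.
move=> [J0 JD JM Jh] homF; split.
- by exists 0 => //; exists 0; rewrite mul0r addr0.
- move=> _ _ [A JA [B ->]] [A' JA' [B' ->]]; exists (A + A'); first exact: JD.
  by exists (B + B'); rewrite mulrDl addrACA.
- move=> _ G [A JA [B ->]]; exists (A * G); first exact: JM.
  by exists (B * G); rewrite mulrDl mulrAC.
move=> e _ [A JA [B ->]]; exists (pihomog mdeg e A); first exact: Jh.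
rewrite linearD /=; have [le_de|lt_ed] := leqP d e.
  exists (pihomog mdeg (e - d) B).
  by have := pihomog_mul_homog (e - d) B homF; rewrite subnK // => ->.
by exists 0; rewrite (pihomog_mul_homog_lt _ homF) // mul0r.
Qed.

(** If F and G are forms outside J, then J + (F) and J + (G) contain a power of
    each coordinate by maximality, and (J + (F)) (J + (G)) is contained in
    J + (F G). *)
Lemma graded_ideal_max_prime J : graded_ideal J -> ~ irrelevant J ->
    (forall M : S -> Prop, graded_ideal M -> ~ irrelevant M ->
      (forall F, J F -> M F) -> forall F, M F -> J F) ->
  exists P : prime_idealr S, homogeneous_ideal (P : {pred S}) /\
    forall F, F \in (P : {pred S}) <-> J F.
Proof.
move=> idJ irrJ maxJ; have [J0 JD JM Jh] := idJ.
have irr_adjoin d F : F \is d.-homog -> ~ J F -> irrelevant (adjoin J F).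
  move=> homF nJF; apply: contrapT => irrJF; apply: nJF.
  apply: (maxJ _ (graded_ideal_adjoin idJ homF) irrJF).
    by move=> G JG; exists G => //; exists 0; rewrite mul0r addr0.
  by exists 0 => //; exists 1; rewrite mul1r add0r.
have [|||||P [homP PE]] := @homogeneous_prime k n (fun=> J).
- by [].
- by move=> d F G _ _; exact: JD.
- by move=> d e F G _ _; exact: JM.
- by move=> J1; apply: irrJ => i; exists 0; rewrite expr0.
- move=> d e F G homF homG JFG; apply: contrapT.
  move=> /not_orP[/(irr_adjoin _ _ homF) JF /(irr_adjoin _ _ homG) JG].
  apply: irrJ => i; have [N [A JA [B XE]]] := JF i.
  have [N' [A' JA' [B' XE']]] := JG i; exists (N + N')%N.
  rewrite exprD XE XE'.
  have -> : (A + B * F) * (A' + B' * G) =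
      A * (A' + B' * G) + A' * (B * F) + F * G * (B * B').
    by ring.
  by apply: (JD); [apply: (JD)|]; exact: JM.
exists P; split=> // F; rewrite homogeneous_idealP //.
split=> [PF|JF d]; last by apply/PE; [exact: pihomogP | exact: Jh].
rewrite [F](pihomog_partitionE (leqnn (msize F))).
elim/big_rec: _ => // d G _ JG; apply: JD => //.
by apply/(PE d); first exact: pihomogP.
Qed.

(** The sum runs over all monomials of degree at most d, the others being
    replaced by 0, because these form a finite type. *)
Lemma cls_monomial_expansion (I : prime_idealr S) d F : F \is d.-homog ->
  cls I F = \sum_(m : 'X_{1..n.+1 < d.+1})
    cst I F@_m * (if mdeg m == d then cls I 'X_[m] else 0).
Proof.
move=> homF; rewrite [in LHS](mpolywE (k := d.+1) (p := F)).
  rewrite rmorph_sum; apply: eq_bigr => m _; rewrite /= clsZ.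
  case: ifP => // /negbT md.
  by rewrite (dhomog_nemf_coeff homF md) rmorph0 !mul0r.
rewrite msizeE; apply/bigmax_leqP_seq => m mF _.
by rewrite (dhomog_mf homF).
Qed.

Lemma cls_monomial (I : prime_idealr S) (x : 'I_n.+1 -> k)
    (l : {fraction (coord_ring I)}) m :
    (forall j, cls I 'X_j = cst I (x j) * l) ->
  cls I 'X_[m] = cst I ('X_[m]).@[x] * l ^+ mdeg m.
Proof.
move=> clsX; rewrite mevalX rmorph_prod /= mpolyXE_id rmorph_prod /=.
rewrite mdegE -prodrXr -big_split /=.
by apply: eq_bigr => j _; rewrite !rmorphXn /= clsX exprMn.
Qed.

(** If the coordinates are proportional to constants in the function ring, as
    they are on a single point, a form is its value times a power of the
    proportionality factor l. *)
Lemma cls_homog (I : prime_idealr S) (x : 'I_n.+1 -> k)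
    (l : {fraction (coord_ring I)}) d F :
    F \is d.-homog -> (forall j, cls I 'X_j = cst I (x j) * l) ->
  cls I F = cst I F.@[x] * l ^+ d.
Proof.
move=> homF clsX; rewrite mevalE rmorph_sum mulr_suml [in LHS](mpolyE F).
rewrite rmorph_sum /=.
rewrite big_seq [RHS]big_seq; apply: eq_bigr => m mF.
rewrite clsZ (cls_monomial _ clsX) mevalX rmorphM /= (dhomog_mf homF) //.
by rewrite mulrA.
Qed.

End GradedIdeals.

Section Nullstellensatz.
Variables (k : closedFieldType) (n : nat).
Local Notation S := {mpoly k[n.+1]}.

(** The monomials of degree d span the space of forms of degree d, which
    multiplication by a stabilizes. *)
Lemma graded_multiplier_const (I : prime_idealr S)
    (a : {fraction (coord_ring I)}) d :
    (forall m, mdeg m = d ->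
      exists2 B, B \is d.-homog & a * cls I 'X_[m] = cls I B) ->
    (exists2 m, mdeg m = d & 'X_[m] \notin (I : {pred S})) ->
  exists c, a = cst I c.
Proof.
move=> am [m0 m0d nIm0].
have /choice[B BP] (m : 'X_{1..n.+1}) : exists B : S, mdeg m = d ->
    B \is d.-homog /\ a * cls I 'X_[m] = cls I B.
  have [/am[B homB aB]|/eqP ne_md] := eqVneq (mdeg m) d; first by exists B.
  by exists 0 => /ne_md.
pose v (m : 'X_{1..n.+1 < d.+1}) := if mdeg m == d then cls I 'X_[m] else 0.
pose M (m m' : 'X_{1..n.+1 < d.+1}) := if mdeg m == d then (B m)@_m' else 0.
have lt_m0 : (mdeg m0 < d.+1)%N by rewrite m0d.
apply: (@stable_span_scalar _ _ (cst I) _ v M a (BMultinom lt_m0)).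
  by rewrite /v /= m0d eqxx cls_eq0.
move=> m; rewrite /v /M; case: eqP => [md|_].
  by have [homB ->] := BP _ md; exact: cls_monomial_expansion.
by rewrite mulr0 big1 // => m' _; rewrite rmorph0 mul0r.
Qed.

(** A maximal homogeneous ideal which does not contain a power of the irrelevant
    ideal is the ideal of a point: modulo it, all forms of large degree are
    multiples of a nonzero coordinate X_i, hence the ratios X_j / X_i stabilize
    a finite-dimensional space and are constants. *)
Theorem projective_nullstellensatz (J : S -> Prop) : graded_ideal J ->
    (forall x : 'rV[k]_n.+1, x != 0 -> exists2 F, J F & F.@[x 0] != 0) ->
  irrelevant J.
Proof.
move=> idJ zeroJ; apply: contrapT => /(graded_ideal_max idJ).
move=> [M [idM irrM JM maxM]].
have [P [homP PE]] := graded_ideal_max_prime idM irrM maxM.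
have /existsNP[i /forallNP nMi] := irrM; have {}nMi N : 'X_i ^+ N \notin P.
  by apply/negP => /PE; exact: nMi.
have nPi : 'X_i \notin P by have := nMi 1; rewrite expr1.
pose l := cls P 'X_i; have nz_l : l != 0 by rewrite cls_eq0.
have homX j : ('X_j : S) \is 1.-homog by rewrite dhomogX /= mdeg1.
have irr_adjoin : irrelevant (adjoin M 'X_i).
  apply: contrapT => irrMi; apply/negP/negPn: nPi; apply/PE.
  apply: (maxM _ (graded_ideal_adjoin idM (homX i)) irrMi).
    by move=> G MG; exists G => //; exists 0; rewrite mul0r addr0.
  by exists 0; [case: idM | exists 1; rewrite mul1r add0r].
(* Modulo M, forms of degree N + 1 are multiples of X_i by forms of degree N. *)
have [N adjN] :=
  irrelevant_monomials (graded_ideal_adjoin idM (homX i)) irr_adjoin.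
have /choice[x xE] j : exists c, cls P 'X_j / l = cst P c.
  apply: (@graded_multiplier_const _ _ N) => [m mN|]; last first.
    exists (U_(i) *+ N)%MM; first by rewrite mdegMn mdeg1 mul1n.
    by rewrite -mpolyXn.
  have [|A MA [B XE]] := adjN (U_(j) + m)%MM.
    by rewrite mdegD mdeg1 mN leqnSn.
  exists (pihomog mdeg N B); first exact: pihomogP.
  rewrite mulrAC; apply: (canLR (mulfK nz_l)); rewrite -!rmorphM -mpolyXD.
  apply/eqP; rewrite -subr_eq0 -rmorphB cls_eq0; apply/PE.
  have := congr1 (pihomog mdeg (N + 1)) XE.
  rewrite linearD /= (pihomog_mul_homog _ _ (homX i)) pihomog_dE.
    by move=> ->; rewrite addrK; case: idM => _ _ _; apply.
  by rewrite dhomogX /= mdegD mdeg1 mN addnC.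
have clsX j : cls P 'X_j = cst P (x j) * l by rewrite -xE divfK.
have nz_x : \row_j x j != 0.
  apply/eqP => /rowP/(_ i); rewrite !mxE => xi0.
  by have /eqP := clsX i; rewrite xi0 rmorph0 mul0r (negPf nz_l).
(* The point with coordinates x j is a zero of M, hence of J. *)
have [F JF] := zeroJ _ nz_x; rewrite (meval_eq (v2 := x)); last first.
  by move=> j; rewrite mxE.
rewrite [F](pihomog_partitionE (leqnn (msize F))) raddf_sum /= big1 ?eqxx //.
move=> d _; apply: (fmorph_inj (cst P)).
apply: (mulIf (expf_neq0 d nz_l)).
rewrite -(cls_homog (pihomogP _ _ _) clsX) rmorph0 mul0r; apply/eqP.
by rewrite cls_eq0; apply: homP; apply/PE/JM.
Qed.

End Nullstellensatz.

(** * Rational functions and local rings *)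

Section Fractions.
Variables (k : fieldType) (n : nat) (I : prime_idealr {mpoly k[n.+1]}).
Local Notation S := {mpoly k[n.+1]}.
Local Notation K := {fraction (coord_ring I)}.

(** Common form of the function field and of the local rings, which differ only
    in the denominators allowed. *)
Definition fraction_over (D : S -> Prop) (phi : K) : Prop :=
  exists (d : nat) (F G : S), [/\ F \is d.-homog, G \is d.-homog, D G &
    phi = cls I F / cls I G].

Section Denominators.
Variable D : S -> Prop.
Hypothesis D1 : D 1.
Hypothesis DM : forall F G, D F -> D G -> D (F * G).
Hypothesis D_notin : forall F, D F -> F \notin (I : {pred S}).

Lemma fraction_over_cst c : fraction_over D (cst I c).
Proof.
exists 0, c%:MP, 1; split=> //; rewrite ?dhomog1 //;
  last by rewrite rmorph1 divr1.
by rewrite -[c]mulr1 mpolyCM mul_mpolyC rpredZ // mpolyC1 dhomog1.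
Qed.

Lemma fraction_overB a b :
  fraction_over D a -> fraction_over D b -> fraction_over D (a - b).
Proof.
move=> [d [F [G [homF homG DG ->]]]] [e [F' [G' [homF' homG' DG' ->]]]].
exists (d + e)%N, (F * G' - F' * G), (G * G'); split.
- by rewrite [F' * G]mulrC rpredB ?dhomogM.
- by rewrite dhomogM.
- exact: DM.
rewrite rmorphB !rmorphM /= -(mulNr (cls I F') (cls I G')^-1).
by rewrite addf_div ?cls_eq0 ?D_notin // mulNr.
Qed.

Lemma fraction_overM a b :
  fraction_over D a -> fraction_over D b -> fraction_over D (a * b).
Proof.
move=> [d [F [G [homF homG DG ->]]]] [e [F' [G' [homF' homG' DG' ->]]]].
exists (d + e)%N, (F * F'), (G * G'); split; rewrite ?dhomogM //.
  exact: DM.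
by rewrite !rmorphM mulf_div.
Qed.

End Denominators.

Lemma function_field_cst c : function_field (cst I c).
Proof.
by apply: fraction_over_cst; rewrite (proper_ideal_subproof (s := I)).1.
Qed.

Lemma function_fieldM (a b : K) :
  function_field a -> function_field b -> function_field (a * b).
Proof.
by apply: fraction_overM => F G nF nG; rewrite prime_idealrM negb_or nF.
Qed.

Lemma function_fieldB (a b : K) :
  function_field a -> function_field b -> function_field (a - b).
Proof.
apply: fraction_overB => // F G nF nG; by rewrite prime_idealrM negb_or nF.
Qed.

Lemma function_fieldV (a : K) : function_field a -> function_field a^-1.
Proof.
move=> [d [F [G [homF homG nG ->]]]]; have [IF|nF] := boolP (F \in I).
  exists 0, 0, 1; split; rewrite ?rpred0 ?dhomog1 ?idealr1 //.
  by move: IF; rewrite -cls_eq0 => /eqP->; rewrite rmorph0 !mul0r invr0.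
by exists d, G, F; split=> //; rewrite invf_div.
Qed.

Lemma function_fieldX (a : K) i : function_field a -> function_field (a ^+ i).
Proof.
move=> ffa; elim: i => [|i IHi]; last by rewrite exprS; exact: function_fieldM.
by rewrite expr0 -(rmorph1 (cst I)); exact: function_field_cst.
Qed.

Section AtPoint.
Variable x : 'rV[k]_n.+1.
Hypothesis x_on : on_X I x.

Lemma nonvanishing_notin F : F.@[x 0] != 0 -> F \notin (I : {pred S}).
Proof. by apply: contra_neqN => IF; case: x_on => _; exact. Qed.

Lemma local_ring_cst c : local_ring x (cst I c).
Proof. by apply: fraction_over_cst; rewrite meval1 oner_neq0. Qed.

Lemma local_ring0 : local_ring x (0 : K).
Proof. by rewrite -(rmorph0 (cst I)); exact: local_ring_cst. Qed.

Lemma local_ring1 : local_ring x (1 : K).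
Proof. by rewrite -(rmorph1 (cst I)); exact: local_ring_cst. Qed.

Lemma local_ringM (a b : K) :
  local_ring x a -> local_ring x b -> local_ring x (a * b).
Proof. by apply: fraction_overM => F G nF nG; rewrite mevalM mulf_neq0. Qed.

Lemma local_ringB (a b : K) :
  local_ring x a -> local_ring x b -> local_ring x (a - b).
Proof.
apply: fraction_overB => [F G nF nG|]; last exact: nonvanishing_notin.
by rewrite mevalM mulf_neq0.
Qed.

Lemma local_ringD (a b : K) :
  local_ring x a -> local_ring x b -> local_ring x (a + b).
Proof.
move=> Oa Ob; rewrite -[b]opprK; apply: local_ringB => //.
by rewrite -[- b]add0r; apply: local_ringB => //; exact: local_ring0.
Qed.

Lemma local_ringX (a : K) i : local_ring x a -> local_ring x (a ^+ i).
Proof.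
move=> Oa; elim: i => [|i IHi]; first by rewrite expr0; exact: local_ring1.
by rewrite exprS; exact: local_ringM.
Qed.

Lemma local_ideal_sub (a : K) : local_ideal x a -> local_ring x a.
Proof. by move=> [d [F [G [homF homG nG _ ->]]]]; exists d, F, G. Qed.

(** Vanishing at x does not depend on the fraction chosen to represent a regular
    function, because I vanishes at x. *)
Lemma local_ideal_vanish d F G : F \is d.-homog -> G \is d.-homog ->
  G.@[x 0] != 0 -> local_ideal x (cls I F / cls I G) -> F.@[x 0] = 0.
Proof.
move=> homF homG nG [e [F' [G' [homF' homG' nG' F'0 /eqP]]]].
rewrite eqr_div ?cls_eq0 ?nonvanishing_notin // -!rmorphM -subr_eq0 -rmorphB.
rewrite cls_eq0 => /(proj2 x_on); rewrite mevalB !mevalM F'0 mul0r subr0.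
by move/eqP; rewrite mulf_eq0 (negPf nG') orbF => /eqP.
Qed.

Lemma local_ideal1 : ~ local_ideal x (1 : K).
Proof.
rewrite -(divr1 1) -(rmorph1 (cls I)).
move=> /(local_ideal_vanish (dhomog1 _ _) (dhomog1 _ _)).
by rewrite meval1 => /(_ (oner_neq0 _))/eqP; rewrite oner_eq0.
Qed.

Lemma local_idealM (a b : K) :
  local_ideal x a -> local_ring x b -> local_ideal x (a * b).
Proof.
move=> [d [F [G [homF homG nG F0 ->]]]] [e [F' [G' [homF' homG' nG' ->]]]].
exists (d + e)%N, (F * F'), (G * G').
split; rewrite ?dhomogM // ?mevalM ?mulf_neq0 ?F0 ?mul0r //.
by rewrite !rmorphM mulf_div.
Qed.

Lemma local_unitP (a : K) :
  local_unit x a <-> local_ring x a /\ ~ local_ideal x a.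
Proof.
split=> [[nz_a Oa OVa]|[Oa nma]].
  by split=> // /local_idealM/(_ OVa); rewrite mulfV //; exact: local_ideal1.
case: (Oa) nma => d [F [G [homF homG nG ->]]] nma.
have nF : F.@[x 0] != 0 by apply/eqP => F0; apply: nma; exists d, F, G.
split; [|by exists d, F, G|by exists d, G, F; rewrite invf_div].
by rewrite mulf_neq0 ?invr_eq0 ?cls_eq0 ?nonvanishing_notin.
Qed.

Lemma local_unitM (a b : K) :
  local_unit x a -> local_unit x b -> local_unit x (a * b).
Proof.
move=> [nz_a Oa OVa] [nz_b Ob OVb]; have OVab := local_ringM OVa OVb.
split; [exact: (mulf_neq0 nz_a nz_b)|exact: local_ringM|].
by rewrite (invfM a b).
Qed.

Lemma local_unitV (a : K) : local_unit x a -> local_unit x a^-1.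
Proof. by move=> [nz_a Oa OVa]; split; rewrite ?(invr_eq0 a) ?(invrK a). Qed.

Lemma local_unitX (a : K) i : local_unit x a -> local_unit x (a ^+ i).
Proof.
move=> [nz_a Oa OVa]; split; first exact: (expf_neq0 i nz_a).
  exact: local_ringX.
by rewrite -(exprVn a i); exact: local_ringX.
Qed.

(** The residue field of a point is k. *)
Lemma local_value (a : K) :
  local_ring x a -> exists c, local_ideal x (a - cst I c).
Proof.
move=> [d [F [G [homF homG nG ->]]]]; exists (F.@[x 0] / G.@[x 0]).
exists d, (F - (F.@[x 0] / G.@[x 0]) *: G), G; split=> //.
- by rewrite rpredB ?rpredZ.
- by rewrite mevalB mevalZ divfK ?subrr.
by rewrite rmorphB /= clsZ mulrBl mulfK // cls_eq0 nonvanishing_notin.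
Qed.

End AtPoint.
End Fractions.

(** * Orders with respect to a uniformizer *)

Lemma divf_exprz_scale (K : fieldType) (a c u : K) (j : int) : c != 0 ->
  a / u ^ j = a / (c * u) ^ j * c ^ j.
Proof.
by move=> nz_c; rewrite expfzMl invfM mulrA mulrAC mulfVK // expfz_neq0.
Qed.

Lemma divf_common_denom (K : fieldType) (a b c l : K) : b != 0 ->
  a / l / c = a / b / c * (b / l).
Proof. by move=> nz_b; rewrite [RHS]mulrAC mulrA divfK. Qed.

Lemma divf_cancel_denom (K : fieldType) (a b l : K) : l != 0 ->
  a / l / (b / l) = a / b.
Proof. by move=> nz_l; rewrite invf_div mulrA divfK. Qed.

(** By dvr_unit the non-units are the multiples of u.  The order theory below
    applies before the intersection of the powers of u is known to be zero; an
    element of that intersection has no order. *)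
Record discrete_valuation_ring (K : fieldType) (O : K -> Prop) (u : K) : Prop :=
  DiscreteValuationRing {
    dvr1 : O 1;
    dvrB : forall a b, O a -> O b -> O (a - b);
    dvrM : forall a b, O a -> O b -> O (a * b);
    dvr_unif : O u;
    dvr_nunit : ~ O u^-1;
    dvr_unit : forall a, O a -> ~ O (a / u) -> O a^-1 }.

Section DiscreteValuation.
Variables (K : fieldType) (O : K -> Prop) (u : K).
Hypothesis V : discrete_valuation_ring O u.
Let O1 := dvr1 V.
Let OB := dvrB V.
Let OM := dvrM V.
Let Ou := dvr_unif V.
Let nOVu := dvr_nunit V.
Let unit_out := dvr_unit V.

Definition order_ge (j : int) (a : K) : Prop := O (a / u ^ j).
Definition order_is (a : K) (j : int) : Prop :=
  [/\ a / u ^ j != 0, O (a / u ^ j) & O (a / u ^ j)^-1].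

Lemma uniformizer_neq0 : u != 0.
Proof.
by apply/eqP => u0; apply: nOVu; rewrite u0 invr0 -(subrr 1); exact: OB.
Qed.

Let nz_u := uniformizer_neq0.

Lemma order_ge0 j : order_ge j 0.
Proof. by rewrite /order_ge mul0r -(subrr 1); exact: OB. Qed.

Lemma order_geB j a b : order_ge j a -> order_ge j b -> order_ge j (a - b).
Proof. by rewrite /order_ge mulrBl; exact: OB. Qed.

Lemma order_ge_anti i j a : i <= j -> order_ge j a -> order_ge i a.
Proof.
move=> le_ij; have [d ->] : exists d : nat, j = i + d%:Z.
  by exists `|j - i|%N; rewrite gez0_abs ?subr_ge0 // [i + _]addrC subrK.
rewrite /order_ge expfzDr // => Oa.
have -> : a / u ^ i = a / (u ^ i * u ^ d) * u ^+ d.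
  by rewrite invfM mulrA divfK // expf_neq0.
by apply: OM => //; elim: d {Oa} => [|d IHd]; rewrite ?exprS //; exact: OM.
Qed.

(** Having order j means being divisible by the j-th power of u but not by the
    next one, as an element of O not divisible by u is a unit. *)
Lemma order_isP a j : order_is a j <-> order_ge j a /\ ~ order_ge (j + 1) a.
Proof.
have divE : a / u ^ (j + 1) = (a / u ^ j) / u.
  by rewrite expfzDr // expr1z invfM mulrA.
rewrite /order_ge divE; split=> [[nz_a Oa OVa]|[Oa nOa]].
  by split=> // /(OM OVa); rewrite mulKf.
split=> //; last exact: unit_out.
by apply/eqP => a0; apply: nOa; rewrite a0 mul0r -(subrr 1); exact: OB.
Qed.

Lemma order_is_ge a i j : order_is a j -> order_ge i a <-> i <= j.
Proof.
move=> /order_isP[ge_j nge_j1]; split=> [ge_i|le_ij].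
  rewrite leNgt; apply/negP; rewrite -lezD1 => lt_ji; apply: nge_j1.
  exact: order_ge_anti ge_i.
exact: order_ge_anti ge_j.
Qed.

Lemma order_is_uniq a i j : order_is a i -> order_is a j -> i = j.
Proof.
move=> ai aj; have [gei _] := (order_isP _ _).1 ai.
have [gej _] := (order_isP _ _).1 aj; apply/le_anti/andP.
by split; [apply/(order_is_ge _ aj) | apply/(order_is_ge _ ai)].
Qed.

Lemma order_is_neq0 a j : order_is a j -> a != 0.
Proof. by move=> [nz_a _ _]; apply: contraNneq nz_a => ->; rewrite mul0r. Qed.

Lemma order_isM a b i j :
  order_is a i -> order_is b j -> order_is (a * b) (i + j).
Proof.
move=> [nz_a Oa OVa] [nz_b Ob OVb]; rewrite /order_is expfzDr // -mulf_div.
by split; [exact: mulf_neq0|exact: OM|rewrite invfM; exact: OM].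
Qed.

Lemma order_isV a j : order_is a j -> order_is a^-1 (- j).
Proof.
move=> [nz_a Oa OVa]; have eV : a^-1 / u ^ (- j) = (a / u ^ j)^-1.
  by rewrite -invr_expz invrK invf_div mulrC.
by rewrite /order_is eV invr_eq0 invrK.
Qed.

Lemma order_isX a j i : order_is a j -> order_is (a ^+ i) (j *+ i).
Proof.
move=> aj; elim: i => [|i IHi]; last by rewrite exprS mulrS; exact: order_isM.
by rewrite /order_is expr0 divr1 invr1 oner_neq0.
Qed.

Lemma order_is_frac a b i j :
  order_is a i -> order_is b j -> order_is (a / b) (i - j).
Proof. by move=> ai /order_isV; exact: order_isM. Qed.

Lemma order_is_nat a : O a -> (exists j : nat, ~ O (a / u ^+ j)) ->
  exists j : nat, order_is a j%:Z.
Proof.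
move=> Oa [j0 nOj0].
have exj : exists j : nat, `[< ~ O (a / u ^+ j) >] by exists j0; apply/asboolP.
case: (ex_minnP exj) => -[|j] /asboolP nOj minj.
  by case: nOj; rewrite divr1.
exists j; apply/order_isP; split; last by rewrite addrC -intS.
apply: contrapT => nO; suff : (j < j)%N by rewrite ltnn.
by apply: minj; apply/asboolP.
Qed.

(** If a / b has residue c then c * b cancels the leading term of a. *)
Lemma order_ge_residue a b c j : order_is b j ->
    O ((a / u ^ j * (b / u ^ j)^-1 - c) / u) ->
  order_ge (j + 1) (c * b - a).
Proof.
rewrite /order_is /order_ge; set A := a / u ^ j; set B := b / u ^ j.
move=> [nz_B ordB _] Oc.
have -> : (c * b - a) / u ^ (j + 1) = 0 - (A / B - c) / u * B.
  rewrite expfzDr // expr1z invfM mulrA mulrBl -[c * b / _]mulrA -/A -/B.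
  rewrite sub0r [_ / u * B]mulrAC [(_ - c) * B]mulrBl divfK //.
  by rewrite -[in RHS]mulNr opprB.
by apply: OB; [rewrite -(subrr 1); exact: OB | exact: OM].
Qed.

End DiscreteValuation.

(** * Functions regular everywhere are constant *)

Section Scaling.
Variables (k : fieldType) (n : nat) (I : prime_idealr {mpoly k[n.+1]}).
Local Notation S := {mpoly k[n.+1]}.
Local Notation K := {fraction (coord_ring I)}.

Lemma meval_scale (c : k) (x : 'rV[k]_n.+1) d (F : S) : F \is d.-homog ->
  F.@[(c *: x) 0] = c ^+ d * F.@[x 0].
Proof.
move=> homF; rewrite !mevalE mulr_sumr big_seq [RHS]big_seq.
apply: eq_bigr => m mF; rewrite mulrCA; congr (_ * _).
rewrite -(dhomog_mf homF mF) /= mdegE -prodrXr -big_split /=.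
by apply: eq_bigr => i _; rewrite mxE exprMn.
Qed.

Lemma local_ring_same_point (x y : 'rV[k]_n.+1) (a : K) :
  same_point x y -> local_ring y a <-> local_ring x a.
Proof.
move=> [c nz_c ->]; split=> -[d [F [G [homF homG nG ->]]]]; exists d, F, G;
  split=> //; move: nG; rewrite (meval_scale _ _ homG) mulf_eq0 negb_or;
  by rewrite expf_neq0.
Qed.

Lemma local_ideal_same_point (x y : 'rV[k]_n.+1) (a : K) :
  same_point x y -> local_ideal y a <-> local_ideal x a.
Proof.
move=> [c nz_c ->]; have nz_cd d : c ^+ d != 0 by rewrite expf_neq0.
split=> -[d [F [G [homF homG nG F0 ->]]]]; exists d, F, G; split=> //.
- by move: nG; rewrite (meval_scale _ _ homG) mulf_eq0 negb_or nz_cd.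
- move/eqP: F0; rewrite (meval_scale _ _ homF) mulf_eq0 (negPf (nz_cd d)).
  by move/eqP.
- by rewrite (meval_scale _ _ homG) mulf_neq0.
- by rewrite (meval_scale _ _ homF) F0 mulr0.
Qed.
End Scaling.

Section Regular.
Variables (k : closedFieldType) (n : nat) (I : prime_idealr {mpoly k[n.+1]}).
Local Notation S := {mpoly k[n.+1]}.
Local Notation K := {fraction (coord_ring I)}.

(** The forms G such that a * G is a form again are the denominators of a.  They
    generate an ideal without zeros: on X because a is regular there, and
    elsewhere because it contains I.  So it contains all forms of some degree
    N, and multiplication by a stabilizes the forms of degree N. *)
Theorem regular_function_const (a : K) : proj_prime I ->
  (forall x, on_X I x -> local_ring x a) -> exists c, a = cst I c.
Proof.
move=> [homI [i nIi]] rega.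
pose J (F : S) := forall d, exists2 H : S, H \is d.-homog &
  a * cls I (pihomog mdeg d F) = cls I H.
have homJ d F : F \is d.-homog ->
    (exists2 H, H \is d.-homog & a * cls I F = cls I H) -> J F.
  move=> homF JF e; have [<-|ne_de] := eqVneq d e; first by rewrite pihomog_dE.
  by exists 0; rewrite ?rpred0 // (pihomog_ne0 ne_de homF) !rmorph0 mulr0.
have idJ : graded_ideal J.
  split.
  - by move=> d; exists 0; rewrite ?rpred0 // !raddf0 mulr0.
  - move=> F G JF JG d; have [H homH aF] := JF d; have [H' homH' aG] := JG d.
    by exists (H + H'); rewrite ?rpredD // linearD !rmorphD mulrDr aF aG.
  - move=> F G JF d; have /choice[H HP] j : exists H, H \is j.-homog /\
        a * cls I (pihomog mdeg j F) = cls I H.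
      by have [H homH aF] := JF j; exists H.
    exists (\sum_(j < d.+1) H (d - j)%N * pihomog mdeg j G).
      apply: rpred_sum => j _; have [homH _] := HP (d - j)%N.
      by have := dhomogM homH (pihomogP mdeg j G); rewrite subnK ?leq_ord.
    rewrite pihomogM !rmorph_sum mulr_sumr; apply: eq_bigr => j _ /=.
    by rewrite !rmorphM mulrA (HP _).2.
  - by move=> d F JF; apply: (homJ d); [exact: pihomogP | exact: JF].
have irrJ : irrelevant J.
  apply: projective_nullstellensatz idJ _ => x nz_x.
  have [x_on|] := pselect (on_X I x).
    have [d [F [G [homF homG nG aE]]]] := rega x x_on.
    exists G => //; apply: (homJ d) => //; exists F => //.
    by rewrite aE divfK // cls_eq0 (nonvanishing_notin x_on).
  move=> /not_andP[/(_ nz_x)//|/existsNP[F /not_implyP[IF /eqP nF]]].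
  exists F => // d; exists 0; rewrite ?rpred0 //.
  by have := homI F d IF; rewrite -cls_eq0 => /eqP->; rewrite rmorph0 mulr0.
have [N JN] := irrelevant_monomials idJ irrJ.
apply: (@graded_multiplier_const _ _ _ _ N) => [m mN|].
  have [|H homH] := JN m _ N; first by rewrite mN.
  by rewrite pihomog_dE ?dhomogX /= ?mN //; exists H.
exists (U_(i) *+ N)%MM; first by rewrite mdegMn mdeg1 mul1n.
rewrite -mpolyXn -cls_eq0 rmorphXn expf_eq0 negb_and.
by rewrite [X in _ || X](_ : _ = true) ?orbT // cls_eq0.
Qed.
End Regular.

(** * The order of a rational function at a smooth point *)

Section SmoothPoint.
Variables (k : fieldType) (n : nat) (I : prime_idealr {mpoly k[n.+1]}).
Local Notation S := {mpoly k[n.+1]}.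
Local Notation K := {fraction (coord_ring I)}.
Hypothesis X_curve : projective_curve I.
Variable p : 'rV[k]_n.+1.
Hypothesis p_on : on_X I p.
Variable u : K.
Hypothesis u_unif : uniformizer p u.

Lemma coordinate_neq0 : exists i, p 0 i != 0.
Proof.
apply: contrapT => /forallNP p0; case: p_on => /eqP + _; apply.
by apply/rowP => i; rewrite mxE; apply/eqP/negPn/negP/p0.
Qed.

Lemma homog_coord d i : ('X_i ^+ d : S) \is d.-homog.
Proof. by rewrite mpolyXn dhomogX /= mdegMn mdeg1 mul1n. Qed.

Lemma dehomogenize_local d i F : p 0 i != 0 -> F \is d.-homog ->
  local_ring p (cls I F / cls I 'X_i ^+ d).
Proof.
move=> pi homF; exists d, F, ('X_i ^+ d); rewrite homog_coord !rmorphXn /=.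
by split; rewrite // mevalXU expf_neq0.
Qed.

Lemma coordinate_cls_neq0 i : p 0 i != 0 -> cls I 'X_i != 0.
Proof. by move=> pi; rewrite cls_eq0 (nonvanishing_notin p_on) ?mevalXU. Qed.

(** If u = 0 then a form vanishing at p lies in I, so I is the ideal of p; a
    strictly larger homogeneous prime then contains a coordinate X_i with
    p_i <> 0, and so all coordinates, against the positive dimension of X. *)
Lemma uniformizer_nonzero : u != 0.
Proof.
have [_ [[P [PE PS]] _]] := X_curve; have [i pi] := coordinate_neq0.
have nz_l := coordinate_cls_neq0 pi.
apply/eqP => u0.
have inI d F : F \is d.-homog -> F - (F.@[p 0] / p 0 i ^+ d) *: 'X_i ^+ d \in I.
  move=> homF; set G := F - _.
  have homG : G \is d.-homog by rewrite rpredB ?rpredZ ?homog_coord.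
  have [|b _] := u_unif.2 (cls I G / cls I 'X_i ^+ d).
    exists d, G, ('X_i ^+ d); rewrite homog_coord !rmorphXn /= mevalXU.
    split; rewrite ?expf_neq0 // mevalB mevalZ rmorphXn /= mevalXU.
    by rewrite divfK ?subrr ?expf_neq0.
  rewrite u0 mulr0 => /eqP; rewrite mulf_eq0 invr_eq0 expf_eq0 (negPf nz_l).
  by rewrite andbF orbF cls_eq0.
have [[[hom0 rel0] IP0] [[hom1 [j nP1j]] IP1]] := (PE 0 isT, PE 1 isT).
have [_ [F P1F nP0F]] := PS 0 isT.
have [d nP0Fd] : exists d, pihomog mdeg d F \notin P 0.
  apply: contrapT => /forallNP P0Fd; move/negP: nP0F; apply.
  by apply/(homogeneous_idealP _ hom0) => d; apply/negPn/negP/P0Fd.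
have P1Fd := hom1 F d P1F; have homFd := pihomogP mdeg d F.
have IFd := inI _ _ homFd; set c := _ / _ in IFd.
have nz_c : c != 0.
  apply: contraNneq nP0Fd => c0; apply: IP0.
  by move: IFd; rewrite c0 scale0r subr0.
have P1X : 'X_i \in P 1.
  have : c *: 'X_i ^+ d \in P 1.
    by rewrite -[_ *: _](subKr (pihomog mdeg d F)) rpredB // IP1.
  rewrite -mul_mpolyC prime_idealrM => /orP[P1c|].
    have := idealMr (c^-1)%:MP P1c.
    by rewrite -mpolyCM mulVf // mpolyC1 idealr1.
  elim: (d) => [|e IHe]; first by rewrite expr0 idealr1.
  by rewrite exprS prime_idealrM => /orP[].
move/negP: nP1j; apply; have := inI 1 'X_j.
rewrite dhomogX /= mdeg1 => /(_ isT)/IP1 P1j.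
rewrite -['X_j](subrK ((('X_j : S).@[p 0] / p 0 i ^+ 1) *: 'X_i ^+ 1)).
by rewrite rpredD // -mul_mpolyC idealMr.
Qed.

Let O1 := @local_ring1 _ _ I p.
Let OB := @local_ringB _ _ I p p_on.
Let OM := @local_ringM _ _ I p.

Let Ou : local_ring p u.
Proof. exact: local_ideal_sub u_unif.1. Qed.

Let nOVu : ~ local_ring p u^-1.
Proof.
move=> OVu; apply: (local_ideal1 p_on).
by rewrite -(mulfV uniformizer_nonzero); exact: (local_idealM u_unif.1 OVu).
Qed.

Lemma local_idealE (a : K) : local_ideal p a <-> local_ring p (a / u).
Proof.
split=> [/(u_unif.2)[b Ob ->]|Oau].
  by rewrite (mulfK uniformizer_nonzero).
rewrite -(divfK uniformizer_nonzero a) mulrC.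
exact: (local_idealM u_unif.1 Oau).
Qed.

Let unit_out (a : K) :
  local_ring p a -> ~ local_ring p (a / u) -> local_ring p a^-1.
Proof.
move=> Oa nOau; suff [] : local_unit p a by [].
by apply/(local_unitP p_on); split=> // /local_idealE.
Qed.

Lemma local_ring_dvr : discrete_valuation_ring (@local_ring _ _ I p) u.
Proof. by split. Qed.

Let V := local_ring_dvr.

(** Two uniformizers differ by a unit, so orders may be computed with u. *)
Lemma has_ordP (a : K) j :
  has_ord p a j <-> order_is (@local_ring _ _ I p) u a j.
Proof.
split=> [[v v_unif [nz Oa OVa]]|[nz Oa OVa]]; last by exists u.
have [b Ob uE] := v_unif.2 _ u_unif.1; have [c Oc vE] := u_unif.2 _ v_unif.1.
have nz_u := uniformizer_nonzero.
have nz_c : c != 0.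
  apply: contraNneq nz_u => c0; rewrite uE vE c0; apply/eqP.
  by rewrite mul0r mulr0.
have cVE : c^-1 = b.
  apply: (mulIf nz_c); rewrite mulVf //.
  apply: (mulIf nz_u); rewrite mul1r -mulrA -vE; exact: uE.
have c_unit : local_unit p (c ^ j).
  have cu : local_unit p c by split=> //; rewrite cVE.
  case: j {nz Oa OVa} => j; first exact: (local_unitX j cu).
  by rewrite NegzE -exprnN; exact: (local_unitV (local_unitX j.+1 cu)).
have -> : order_is (@local_ring _ _ I p) u a j = local_unit p (a / u ^ j) by [].
have -> : a / u ^ j = a / v ^ j * c ^ j.
  by rewrite vE; exact: divf_exprz_scale.
exact: (local_unitM _ c_unit).
Qed.

(** If a is divisible by all powers of u, the forms with that property, once
    divided by a power of a coordinate, generate a homogeneous prime P1: a form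
    without it has an order, and orders add up.  It lies strictly between I,
    as it contains the numerator of a, and the ideal P2 of p, as it does not
    contain the numerator of u.  This contradicts the dimension of X. *)
Theorem krull_intersection (a : K) : local_ring p a -> a != 0 ->
  exists j : nat, ~ local_ring p (a / u ^+ j).
Proof.
move=> [d0 [F0 [G0 [homF0 homG0 nG0 aE]]]] nz_a; apply/existsNP => Oa.
have [i pi] := coordinate_neq0; have nz_l := coordinate_cls_neq0 pi.
set l := cls I 'X_i in nz_l; have nz_u := uniformizer_nonzero.
pose q d (F : S) := forall j : nat, local_ring p (cls I F / l ^+ d / u ^+ j).
have finite_order b : local_ring p b ->
    ~ (forall j : nat, local_ring p (b / u ^+ j)) ->
    exists j : nat, order_is (@local_ring _ _ I p) u b j%:Z.
  move=> Ob /existsNP nOb; exact: (order_is_nat V Ob nOb).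
have [|||||P1 [hom1 P1E]] := @homogeneous_prime k n q.
- by move=> d j; rewrite rmorph0 !mul0r; exact: local_ring0.
- move=> d F G _ _ qF qG j; rewrite rmorphD !mulrDl; exact: (local_ringD p_on).
- move=> d e F G homF homG qF j.
  have -> : cls I (F * G) / l ^+ (d + e) / u ^+ j =
      cls I F / l ^+ d / u ^+ j * (cls I G / l ^+ e).
    by rewrite rmorphM /= exprD -mulf_div mulrAC.
  by apply: local_ringM (qF j) _; exact: dehomogenize_local.
- by move/(_ 1); rewrite rmorph1 mul1r invr1 mul1r expr1.
- move=> d e F G homF homG qFG; apply: contrapT => /not_orP[nqF nqG].
  have [i1 oF] := finite_order _ (dehomogenize_local pi homF) nqF.
  have [i2 oG] := finite_order _ (dehomogenize_local pi homG) nqG.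
  have := order_isM V oF oG; rewrite mulf_div -rmorphM -exprD -PoszD.
  move=> /(order_isP V)[_]; apply.
  by rewrite addrC -intS; exact: qFG.
have [|||||P2 [hom2 P2E]] := @homogeneous_prime k n (fun _ F => F.@[p 0] = 0).
- by move=> d; rewrite meval0.
- by move=> d F G _ _; rewrite mevalD => -> ->; rewrite addr0.
- by move=> d e F G _ _; rewrite mevalM => ->; rewrite mul0r.
- by rewrite meval1 => /eqP; rewrite oner_eq0.
- move=> d e F G _ _; rewrite mevalM => /eqP.
  by rewrite mulf_eq0 => /orP[]/eqP; [left|right].
have [[homI relI] [_ []]] := X_curve.
have homX : ('X_i : S) \is 1.-homog by rewrite dhomogX /= mdeg1.
have nP2 : 'X_i \notin P2.
  by apply/negP => /(P2E 1 _ homX); rewrite mevalXU; exact/eqP.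
have IP1 : {subset I <= P1}.
  move=> F IF; apply/(homogeneous_idealP _ hom1) => d.
  apply/(P1E d _ (pihomogP _ _ _)) => j.
  have := homI F d IF; rewrite -cls_eq0 => /eqP->; rewrite !mul0r.
  exact: local_ring0.
have P12 : {subset P1 <= P2}.
  move=> F P1F; apply/(homogeneous_idealP _ hom2) => d.
  have homFd := pihomogP mdeg d F.
  apply/(P2E d _ homFd); have := hom1 F d P1F.
  move=> /(P1E d _ homFd)/(_ 1); rewrite expr1 => /local_idealE.
  rewrite -rmorphXn; apply: (local_ideal_vanish p_on homFd (homog_coord d i)).
  by rewrite rmorphXn /= mevalXU expf_neq0.
exists (fun r => if r == 0 then I else if r == 1 then P1 else P2); split.
  have nP1 : 'X_i \notin P1 by apply: contraNN nP2 => /P12.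
  move=> [|[|r]] _ /=; split=> //; do ?split=> //; try by exists i.
  by move=> F IF; apply: P12; exact: IP1.
move=> [|[|//]] _ /=; split=> //.
  exists F0; last first.
    by rewrite -cls_eq0; apply: contraNneq nz_a => F00; rewrite aE F00 mul0r.
  apply/(P1E d0 _ homF0) => j.
  have -> : cls I F0 / l ^+ d0 / u ^+ j = a / u ^+ j * (cls I G0 / l ^+ d0).
    rewrite aE; apply: divf_common_denom; rewrite cls_eq0.
    exact: (nonvanishing_notin p_on).
  by apply: local_ringM (Oa j) _; exact: dehomogenize_local.
have [d [F [G [homF homG nG F0p uE]]]] := u_unif.1.
exists F; first by apply/(P2E d).
apply/negP => /(P1E d _ homF)/(_ 2) OF; apply: nOVu.
have -> : u^-1 = cls I F / l ^+ d / u ^+ 2 * (cls I 'X_i ^+ d / cls I G).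
  rewrite -(divf_common_denom _ _ _ (expf_neq0 d nz_l)) -uE.
  by rewrite expr2 invfM mulrA (mulfV nz_u) mul1r.
apply: local_ringM OF _; exists d, ('X_i ^+ d), G.
by rewrite homog_coord rmorphXn.
Qed.

(** Numerator and denominator have an order, after division by a power of a
    coordinate which does not vanish at p. *)
Lemma function_field_order (a : K) : function_field a -> a != 0 ->
  exists j, order_is (@local_ring _ _ I p) u a j.
Proof.
move=> [d [F [G [homF homG nG aE]]]] nz_a.
have [i pi] := coordinate_neq0; have nz_l := coordinate_cls_neq0 pi.
have ordF H : H \is d.-homog -> cls I H != 0 -> exists j,
    order_is (@local_ring _ _ I p) u (cls I H / cls I 'X_i ^+ d) j.
  move=> homH nz_H; have OH := dehomogenize_local pi homH.
  have [|j ordj] := order_is_nat V OH _; last by exists j.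
  apply: (krull_intersection OH).
  exact: (mulf_neq0 nz_H (invr_neq0 (expf_neq0 d nz_l))).
have [|j1 ord1] := ordF F homF.
  by apply: contraNneq nz_a => F0; rewrite aE F0 mul0r.
have [|j2 ord2] := ordF G homG; first by rewrite cls_eq0.
exists (j1 - j2); have := order_is_frac V ord1 ord2.
by rewrite (divf_cancel_denom _ _ (expf_neq0 d nz_l)) -aE.
Qed.

End SmoothPoint.

(** * A semigroup of pairs of integers *)

Section Semigroups.
Implicit Types (T : nat * int -> Prop) (N : int -> Prop).

Definition combination (gs : seq (nat * int)) (a : nat * int) : Prop :=
  exists c : nat * int -> nat, a = \sum_(e <- gs) e *+ c e.

Lemma combinationD gs a b :
  combination gs a -> combination gs b -> combination gs (a + b).
Proof.
move=> [c ->] [c' ->]; exists (fun e => c e + c' e)%N.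
by rewrite -big_split; apply: eq_bigr => e _; rewrite mulrnDr.
Qed.

(** Without the uniqueness of e in gs, its coefficient would be counted with
    multiplicity. *)
Lemma combination_gen gs e : uniq gs -> e \in gs -> combination gs e.
Proof.
move=> uniq_gs gs_e; exists (fun e' => (e' == e) : nat).
rewrite (bigD1_seq e) //= eqxx mulr1n big1 ?addr0 // => e' /negPf->.
by rewrite mulr0n.
Qed.

Definition splits T (a : nat * int) : Prop := exists b b',
  [/\ T b, T b', a = b + b', (b.1 < a.1)%N & (b'.1 < a.1)%N].

(** The elements of first component at most B are finitely many, as the second
    component is bounded, and they generate T by induction on the first
    component. *)
Lemma graded_monoid_generated T (D B : nat) :
    T 0 -> (forall a b, T a -> T b -> T (a + b)) ->
    (forall a, T a -> 0 <= a.2 <= (D * a.1)%:Z) ->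
    (forall a, T a -> (B < a.1)%N -> splits T a) ->
  exists gs, (forall e, e \in gs -> T e) /\ forall a, T a <-> combination gs a.
Proof.
move=> T0 TD Tbound Tsplit.
pose box := [seq (i, j%:Z) | i <- iota 0 B.+1, j <- iota 0 (D * B).+1].
pose gs := undup [seq a <- box | `[< T a >]].
have gsE a : (a \in gs) = (a \in box) && `[< T a >].
  by rewrite mem_undup mem_filter andbC.
have Tgs e : e \in gs -> T e by rewrite gsE => /andP[_ /asboolP].
exists gs; split=> // a; split=> [|[c ->]]; last first.
  rewrite big_seq; elim/big_rec: _ => // e b /Tgs Te Tb; apply: (TD) => //.
  by elim: (c e) => [|i IHi]; rewrite ?mulr0n // mulrS; exact: TD.
elim: {a}(a.1.+1) {-2}a (leqnn a.1.+1) => // i IHi a; rewrite ltnS => le_ai Ta.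
have [le_aB|lt_Ba] := leqP a.1 B.
  apply: combination_gen; rewrite ?undup_uniq // gsE.
  apply/andP; split; last exact/asboolP.
  have /andP[] := Tbound a Ta; case: a {Ta le_ai} le_aB => a1 [j|j] //= le_aB _.
  rewrite lez_nat => le_j; apply/allpairsP; exists (a1, j).
  rewrite ![_ \in iota _ _]mem_iota !add0n !ltnS /=; split=> //.
  by rewrite (leq_trans le_j) // leq_mul2l le_aB orbT.
have [b [b' [Tb Tb' aE lt_b lt_b']]] := Tsplit a Ta lt_Ba.
by rewrite aE; apply: combinationD; apply: IHi => //; apply: leq_trans le_ai.
Qed.

(** In each residue class modulo c, the elements of N are closed under adding c,
    so that they are eventually all or none of the class. *)
Lemma submonoid_eventually_periodic N (c : nat) : (0 < c)%N -> N c ->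
    (forall a b, N a -> N b -> N (a + b)) ->
  exists M : nat, forall m : nat, (M <= m)%N -> N m -> N (m%:Z - c%:Z).
Proof.
move=> c_gt0 Nc ND.
have /choice[M MP] (r : 'I_c) : exists M : nat, forall m : nat, (M <= m)%N ->
    (m %% c)%N = r -> N m -> N (m%:Z - c%:Z).
  have [[m0 m0r Nm0]|noN] := pselect (exists2 m0 : nat, (m0 %% c)%N = r & N m0).
    exists (m0 + c)%N => m le_m mr _.
    have [t mE] : exists t, m = (m0 + t * c + c)%N.
      have /dvdnP[t tE] : (c %| m - c - m0)%N.
        rewrite -subnDA addnC -eqn_mod_dvd //.
        by rewrite modnDr m0r mr.
      by exists t; rewrite -tE; lia.
    rewrite {}mE {le_m mr m} PoszD addrK.
    elim: t => [|t IHt]; first by rewrite addn0.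
    by rewrite mulSnr addnA PoszD; exact: ND.
  by exists 0 => m _ mr Nm; case: noN; exists m.
exists (\sum_r M r)%N => m le_m Nm.
apply: (MP (Ordinal (ltn_pmod m c_gt0))) => //; apply: leq_trans le_m.
by rewrite (bigD1 (Ordinal (ltn_pmod m c_gt0))) //= leq_addr.
Qed.

(** For d <= 0, or when N has no positive element, (1, d) can be subtracted from
    every element of first component at least 2.  Otherwise pick e > 0 in N; the
    element (e, 0) lies in the semigroup, since d e is in N, and it can be
    subtracted as soon as d i - j is large. *)
Lemma section_semigroup_generated N (d : int) : N 0 ->
    (forall a b, N a -> N b -> N (a + b)) -> (forall a, N a -> 0 <= a) ->
  exists gs,
    (forall e : nat * int, e \in gs -> 0 <= e.2 /\ N (d * e.1%:Z - e.2)) /\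
    forall a, (0 <= a.2 /\ N (d * a.1%:Z - a.2)) <-> combination gs a.
Proof.
move=> N0 ND N_ge0; pose T (a : nat * int) := 0 <= a.2 /\ N (d * a.1%:Z - a.2).
have T0 : T 0 by split=> //=; rewrite mulr0 subr0.
have TD a b : T a -> T b -> T (a + b).
  move=> [a2 Na] [b2 Nb]; split; first exact: addr_ge0.
  by rewrite PoszD mulrDr opprD addrACA; exact: ND.
have Tbound a : T a -> 0 <= a.2 <= (`|d| * a.1)%N%:Z.
  move=> [a2 /N_ge0]; rewrite subr_ge0 a2 => /le_trans; apply.
  by rewrite PoszM ler_wpM2r // lez_abs.
suff [B Tsplit] : exists B : nat, forall a, T a -> (B < a.1)%N -> splits T a.
  exact: graded_monoid_generated T0 TD Tbound Tsplit.
have split1 a : T a -> (1 < a.1)%N -> 0 <= d -> d <= a.2 -> splits T a.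
  case: a => [[//|i] j] [/= j_ge0 Na] i_gt0 d_ge0 le_dj.
  exists (1, d), (i, j - d); split=> //=.
  - by split=> //=; rewrite mulr1 subrr.
  - split; rewrite /= ?subr_ge0 //; congr N: Na; rewrite intS; ring.
  - by congr pair; rewrite /= ?add1n // addrC subrK.
have [d_gt0|d_le0] := ltrP 0 d; last first.
  exists 1 => a Ta lt_a; have [a2 Na] := Ta.
  have := N_ge0 _ Na; rewrite subr_ge0 => le_a.
  have d0 : d = 0.
    apply/le_anti; rewrite d_le0 /= leNgt; apply/negP => d_lt0.
    have := le_trans a2 le_a; rewrite leNgt nmulr_rlt0 //.
    by rewrite ltz_nat (leq_trans _ lt_a).
  by apply: split1; rewrite ?d0.
have [[e e_gt0 Ne]|noN] := pselect (exists2 e : nat, (0 < e)%N & N e);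
  last first.
  exists 1 => a Ta lt_a; have [a2 Na] := Ta.
  apply: split1 => //; first exact: ltW.
  have /eqP : d * a.1%:Z - a.2 = 0.
    case Em: (_ - _) Na (N_ge0 _ Na) => [[|m]|//] Nm _ //.
    by case: noN; exists m.+1; rewrite // -Em.
  by rewrite subr_eq0 => /eqP <-; rewrite ler_peMr ?ltW // lez_nat; apply: ltW.
pose c := (`|d| * e)%N.
have c_gt0 : (0 < c)%N by rewrite muln_gt0 absz_gt0 gt_eqF.
have cE : c%:Z = d * e%:Z by rewrite PoszM gtz0_abs.
have Nc : N c.
  rewrite /c mulnC; elim: (`|d|)%N => [|i IHi]; first by rewrite muln0.
  by rewrite mulnS PoszD; exact: ND.
have [M MP] := submonoid_eventually_periodic c_gt0 Nc ND.
(* If j < d and i > M + e + 1, then d i - j > d (M + e) >= M. *)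
exists (M + e + 1)%N => -[i j] Ta /= lt_i; have [/= a2 Na] := Ta.
have [le_d|lt_d] := leP d j.
  by apply: split1 => //=; [lia | exact: ltW].
have lt_ei : (e < i)%N by lia.
exists (e, 0), ((i - e)%N, j); split=> //=.
- by split=> //=; rewrite subr0 -cE.
- split=> //=; rewrite -subzn ?(ltnW lt_ei) // mulrBr -cE addrAC.
  have := N_ge0 _ Na; case Em: (_ - _) Na => [m|//] Nm _.
  apply: MP => //; rewrite -lez_nat -Em; nia.
- by congr pair; rewrite /= ?add0r //; lia.
- lia.
Qed.
End Semigroups.

(** * Sections of powers of L and pole orders *)

Lemma twist_expand (K : fieldType) (s f a b : K) i : a != 0 -> b != 0 ->
  s * f ^+ i = s / a ^+ i * (f * a / b) ^+ i * b ^+ i.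
Proof.
move=> nz_a nz_b; rewrite -mulrA -exprMn divfK // exprMn [f ^+ i * _]mulrC.
by rewrite mulrA divfK ?expf_neq0.
Qed.

Lemma untwist_expand (K : fieldType) (s f a b : K) i : b != 0 ->
  s / f ^+ i / a ^+ i = s * (f * a / b)^-1 ^+ i * b^-1 ^+ i.
Proof.
move=> nz_b; rewrite -[RHS]mulrA -exprMn invf_div [b / _ / b]mulrAC.
by rewrite mulfV // mul1r exprVn exprMn invfM mulrA.
Qed.

Section Sections.
Variables (k : closedFieldType) (n : nat) (I : prime_idealr {mpoly k[n.+1]}).
Local Notation K := {fraction (coord_ring I)}.
Hypothesis X_curve : projective_curve I.
Variable p : 'rV[k]_n.+1.
Hypothesis p_on : on_X I p.
Variable u : K.
Hypothesis u_unif : uniformizer p u.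
Local Notation ord_is := (order_is (@local_ring _ _ I p) u).
Local Notation ord_ge := (order_ge (@local_ring _ _ I p) u).
Let V := local_ring_dvr X_curve p_on u_unif.

Lemma local_unit_ord0 (a : K) : local_unit p a <-> ord_is a 0.
Proof. by rewrite /order_is expr0z divr1. Qed.

Lemma same_point_refl (x : 'rV[k]_n.+1) : same_point x x.
Proof. by exists 1; rewrite ?oner_neq0 ?scale1r. Qed.

Lemma local_unit_same_point (x : 'rV[k]_n.+1) (a : K) :
  same_point p x -> local_unit x a <-> local_unit p a.
Proof.
by move=> px; split=> -[nz Oa OVa]; split=> //;
  apply/(local_ring_same_point _ px).
Qed.

Lemma has_ord_same_point (x : 'rV[k]_n.+1) (a : K) j :
  same_point p x -> has_ord x a j -> ord_is a j.
Proof.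
move=> px [v [mv v_gen] av]; apply/(has_ordP X_curve p_on u_unif).
exists v; last exact/(local_unit_same_point _ px).
split; first exact/(local_ideal_same_point _ px).
move=> b /(local_ideal_same_point _ px)/v_gen[c Oc ->]; exists c => //.
exact/(local_ring_same_point _ px).
Qed.

Definition regular_off (a : K) : Prop :=
  forall x, on_X I x -> ~ same_point p x -> local_ring x a.

Definition pole_order (m : int) : Prop := exists a : K,
  [/\ function_field a, regular_off a & ord_is a (- m)].

Lemma pole_order0 : pole_order 0.
Proof.
exists 1; split; first by rewrite -(rmorph1 (cst I)); exact: function_field_cst.
  by move=> x _ _; exact: local_ring1.
rewrite oppr0; apply/(local_unit_ord0 1)/(local_unitP p_on).
by split; [exact: local_ring1 | exact: local_ideal1].
Qed.

Lemma pole_orderD m m' : pole_order m -> pole_order m' -> pole_order (m + m').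
Proof.
move=> [a [ffa rega am]] [b [ffb regb bm]]; exists (a * b); split.
- exact: function_fieldM.
- by move=> x x_on xp; apply: local_ringM; [exact: rega | exact: regb].
- by rewrite opprD; exact: (order_isM V am bm).
Qed.

(** A function of positive order at p which is regular elsewhere would be a
    constant vanishing at p. *)
Lemma pole_order_ge0 m : pole_order m -> 0 <= m.
Proof.
move=> [a [ffa rega am]]; rewrite leNgt; apply/negP => m_lt0.
have ma : local_ideal p a.
  apply/(local_idealE X_curve p_on u_unif).
  have : ord_ge 1 a.
    by apply/(order_is_ge V _ am); rewrite -[1]add0r lezD1 oppr_gt0.
  by rewrite /order_ge expr1z.
have [c aE] : exists c, a = cst I c.
  apply: (regular_function_const X_curve.1) => x x_on.
  have [px|npx] := pselect (same_point p x); last exact: rega.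
  by apply/(local_ring_same_point _ px); exact: local_ideal_sub.
have nz_a := order_is_neq0 am.
have := local_idealM ma (local_ring_cst I p c^-1).
rewrite fmorphV /= -aE (mulfV nz_a); exact: local_ideal1.
Qed.

Variable g : 'rV[k]_n.+1 -> K.
Hypothesis g_ff : forall x, on_X I x -> g x != 0 /\ function_field (g x).
Variables (d : int) (h : 'rV[k]_n.+1 -> K) (phi : K).
Hypothesis h_Op : bundle_of_point p d h.
Hypothesis phi_ff : function_field phi.
Hypothesis phi_iso : forall x, on_X I x -> local_unit x (phi * g x / h x).

Let nz_g x : on_X I x -> g x != 0.
Proof. by move/g_ff => []. Qed.

Let nz_h x : on_X I x -> h x != 0.
Proof.
by move=> /phi_iso[nz _ _]; apply: contraNneq nz => ->; rewrite invr0 mulr0.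
Qed.

Let h_p : ord_is (h p) (- d).
Proof.
have pp := same_point_refl p.
exact: has_ord_same_point pp ((h_Op p_on).1 pp).
Qed.

Let h_off x : on_X I x -> ~ same_point p x -> local_unit x (h x).
Proof. by move=> x_on; exact: (h_Op x_on).2. Qed.

(** Multiplication by the i-th power of phi sends L^i into O(i d p): the three
    factors in twist_expand are a regular function, a unit, and a generator of
    the stalk of O(i d p). *)
Lemma section_pole_order i (s : K) j : global_section (tensor_power g i) s ->
  ord_is (s / g p ^+ i) j -> 0 <= j /\ pole_order (d * i%:Z - j).
Proof.
move=> [s_ff s_reg] s_ord; split.
  apply/(order_is_ge V _ s_ord); rewrite /order_ge expr0z divr1; exact: s_reg.
exists (s * phi ^+ i); split.
- by apply: function_fieldM s_ff _; exact: function_fieldX.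
- move=> x x_on npx; rewrite (twist_expand s phi i (nz_g x_on) (nz_h x_on)).
  apply: local_ringM; first apply: local_ringM (s_reg x x_on) _.
    by case: (local_unitX i (phi_iso x_on)).
  by case: (local_unitX i (h_off x_on npx)).
- rewrite (twist_expand s phi i (nz_g p_on) (nz_h p_on)).
  have /local_unit_ord0 fi := local_unitX i (phi_iso p_on).
  have := order_isM V (order_isM V s_ord fi) (order_isX V i h_p).
  by congr order_is; rewrite addr0 opprB mulNrn -[d *+ i]mulr_natr natz.
Qed.

Lemma pole_order_section i j : 0 <= j -> pole_order (d * i%:Z - j) ->
  exists2 s, global_section (tensor_power g i) s & ord_is (s / g p ^+ i) j.
Proof.
move=> j_ge0 [a [a_ff a_reg a_ord]].
pose s := a / phi ^+ i.
have sE x : on_X I x ->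
    s / g x ^+ i = a * (phi * g x / h x)^-1 ^+ i * (h x)^-1 ^+ i.
  by move=> x_on; exact: (untwist_expand _ _ _ _ (nz_h x_on)).
have s_ord x : on_X I x -> same_point p x -> ord_is (s / g x ^+ i) j.
  move=> x_on px; rewrite (sE x x_on).
  have h_ord := has_ord_same_point px ((h_Op x_on).1 px).
  have /(local_unit_same_point _ px)/local_unit_ord0 fi :=
    local_unitX i (local_unitV (phi_iso x_on)).
  have := order_isM V (order_isM V a_ord fi) (order_isX V i (order_isV h_ord)).
  by congr order_is; rewrite addr0 opprK opprB -[d *+ i]mulr_natr natz subrK.
exists s; last exact: s_ord (same_point_refl p).
split.
  by apply: function_fieldM a_ff _; apply/function_fieldV/function_fieldX.
move=> x x_on; have [px|npx] := pselect (same_point p x).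
  apply/(local_ring_same_point _ px).
  have : ord_ge 0 (s / g x ^+ i) by apply/(order_is_ge V _ (s_ord x x_on px)).
  by rewrite /order_ge expr0z divr1.
rewrite /tensor_power (sE x x_on); apply: local_ringM.
  apply: local_ringM; first exact: a_reg.
  by case: (local_unitX i (local_unitV (phi_iso x_on))).
by case: (local_unitX i (local_unitV (h_off x_on npx))).
Qed.
End Sections.

(** * Valuation, associated graded algebra, and Khovanskii bases *)

Section SectionRing.
Variables (k : closedFieldType) (n : nat) (I : prime_idealr {mpoly k[n.+1]}).
Local Notation K := {fraction (coord_ring I)}.
Hypothesis X_curve : projective_curve I.
Variable p : 'rV[k]_n.+1.
Hypothesis p_on : on_X I p.
Variable u : K.
Hypothesis u_unif : uniformizer p u.
Variable g : 'rV[k]_n.+1 -> K.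
Hypothesis g_ff : forall x, on_X I x -> g x != 0 /\ function_field (g x).
Local Notation ord_is := (order_is (@local_ring _ _ I p) u).
Local Notation ord_ge := (order_ge (@local_ring _ _ I p) u).
Let V := local_ring_dvr X_curve p_on u_unif.
Let ordP := has_ordP X_curve p_on u_unif.

Lemma global_section0 i : global_section (tensor_power g i) 0.
Proof.
split; first by rewrite -(rmorph0 (cst I)); exact: function_field_cst.
by move=> x _; rewrite mul0r; exact: local_ring0.
Qed.

Lemma global_sectionB i s t : global_section (tensor_power g i) s ->
  global_section (tensor_power g i) t ->
  global_section (tensor_power g i) (s - t).
Proof.
move=> [ffs regs] [fft regt]; split; first exact: function_fieldB.
move=> x x_on; rewrite mulrBl.
exact: (local_ringB x_on (regs x x_on) (regt x x_on)).
Qed.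

Lemma global_sectionM i j s t : global_section (tensor_power g i) s ->
  global_section (tensor_power g j) t ->
  global_section (tensor_power g (i + j)) (s * t).
Proof.
move=> [ffs regs] [fft regt]; split; first exact: function_fieldM.
move=> x x_on; rewrite /tensor_power exprD -mulf_div.
exact: (local_ringM (regs x x_on) (regt x x_on)).
Qed.

Lemma global_section_cst c : global_section (tensor_power g 0) (cst I c).
Proof.
split; first exact: function_field_cst.
by move=> x _; rewrite /tensor_power expr0 divr1; exact: local_ring_cst.
Qed.

Lemma section_ring0 : section_ring g 0.
Proof. by move=> i; rewrite coef0; exact: global_section0. Qed.

Lemma section_ringB f f' :
  section_ring g f -> section_ring g f' -> section_ring g (f - f').
Proof. by move=> Rf Rf' i; rewrite coefB; exact: global_sectionB. Qed.

Lemma section_ringM f f' :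
  section_ring g f -> section_ring g f' -> section_ring g (f * f').
Proof.
move=> Rf Rf' i; rewrite coefM; elim/big_rec: _ => [|j s _ Rs].
  exact: global_section0.
rewrite addrC -[X in _ + X]opprK; apply: global_sectionB => //.
rewrite -sub0r; apply: global_sectionB; first exact: global_section0.
have := global_sectionM (Rf j) (Rf' (i - j)%N).
by rewrite subnKC ?leq_ord.
Qed.

Lemma section_ringC c : section_ring g (cst I c)%:P.
Proof.
move=> [|i]; rewrite coefC /=; first exact: global_section_cst.
exact: global_section0.
Qed.

Lemma section_order i s : global_section (tensor_power g i) s -> s != 0 ->
  exists j, ord_is (s / g p ^+ i) j.
Proof.
move=> [ffs _] nz_s; have [nz_g ffg] := g_ff p_on.
apply: (function_field_order X_curve p_on u_unif).
  by apply: function_fieldM ffs _; apply/function_fieldV/function_fieldX.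
exact: (mulf_neq0 nz_s (invr_neq0 (expf_neq0 i nz_g))).
Qed.

Definition lead_order (f : {poly K}) j :=
  ord_is (lead_coef f / g p ^+ (size f).-1) j.

Lemma lead_order_exists f :
  section_ring g f -> f != 0 -> exists j, lead_order f j.
Proof.
move=> Rf nz_f; apply: section_order (Rf _) _.
by rewrite -lead_coefE lead_coef_eq0.
Qed.

(** Higher degrees have smaller values, so the leading coefficient decides. *)
Lemma has_valP f a : section_ring g f -> has_val g p f a <->
  [/\ f != 0, a.1 = (size f).-1 & lead_order f a.2].
Proof.
have le_deg i : f`_i != 0 -> (i <= (size f).-1)%N.
  apply: contra_neqT; rewrite -ltnNge => lt_i; apply: nth_default.
  exact: leq_trans (leqSpred _) lt_i.
move=> Rf; split=> [[[i nz_fi [ai f_ord]] minf]|[nz_f a1 f_ord]].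
  have nz_f : f != 0 by apply: contraNneq nz_fi => ->; rewrite coef0.
  have [j f_ord'] := lead_order_exists Rf nz_f.
  have nz_lead : f`_(size f).-1 != 0 by rewrite -lead_coefE lead_coef_eq0.
  have /orP[/=|/andP[/eqP /= a1 _]] : val_le a ((size f).-1, j).
  - by apply: minf nz_lead _; split=> //; apply/ordP.
  - by rewrite ai ltnNge (le_deg i nz_fi).
  split; [exact: nz_f | exact: a1 |].
  by rewrite /lead_order lead_coefE -a1 ai; apply/ordP.
have f_ord' : has_ord p (f`_(size f).-1 / tensor_power g (size f).-1 p) a.2.
  by apply/ordP; rewrite -lead_coefE.
split=> [|i b nz_fi [bi b_ord]].
  by exists (size f).-1; [rewrite -lead_coefE lead_coef_eq0 | split].
rewrite /val_le a1 bi; have := le_deg i nz_fi; rewrite leq_eqVlt.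
move=> /orP[/eqP eq_i|->//]; rewrite eq_i eqxx ltnn /=.
move: b_ord; rewrite eq_i => /ordP b_ord.
by rewrite (order_is_uniq V f_ord b_ord).
Qed.

(** In this form R_(v >= a) is visibly an additive group. *)
Lemma val_geP f a : val_ge g p a f <->
  [/\ section_ring g f, forall i, (a.1 < i)%N -> f`_i = 0 &
    ord_ge a.2 (f`_a.1 / g p ^+ a.1)].
Proof.
have deg_lt i : ((size f).-1 < i)%N -> f`_i = 0.
  by move=> lt_i; apply: nth_default; exact: leq_trans (leqSpred _) lt_i.
split=> [[Rf [->|[b /(has_valP _ Rf)[nz_f b1 f_ord] le_ab]]]|[Rf f0 f_ord]].
- split=> [|i _|]; rewrite ?coef0 //; first exact: section_ring0.
  by rewrite mul0r; exact: (order_ge0 V).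
- have [lt_ba|/andP[/eqP a1 a2]] := orP le_ab; split; try exact: Rf.
  + by move=> i lt_ai; apply: deg_lt; rewrite -b1 (ltn_trans lt_ba).
  + by rewrite (deg_lt a.1) -?b1 // mul0r; exact: (order_ge0 V).
  + by move=> i lt_ai; apply: deg_lt; rewrite -b1 -a1.
  + by rewrite a1 b1 -lead_coefE; apply/(order_is_ge V _ f_ord).
split; first exact: Rf.
have [->|nz_f] := eqVneq f 0; [by left | right].
have [j f_ord'] := lead_order_exists Rf nz_f.
exists ((size f).-1, j); first exact/(has_valP _ Rf).
have nz_lead : f`_(size f).-1 != 0 by rewrite -lead_coefE lead_coef_eq0.
rewrite /val_le /=; have [//|lt_a|eq_a] := ltngtP (size f).-1 a.1.
  by case/eqP: nz_lead; exact: f0.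
rewrite /=; apply/(order_is_ge V _ f_ord').
by rewrite lead_coefE eq_a.
Qed.

(** The values following a = (i, j) are those at least (i, j + 1). *)
Lemma val_gtP f a : val_gt g p a f <-> val_ge g p (a.1, a.2 + 1) f.
Proof.
have ltE b : val_lt a b = val_le (a.1, a.2 + 1) b.
  case: a b => [a1 a2] [b1 b2]; rewrite /val_lt /val_le /= xpair_eqE lezD1.
  by have [lt_ba|lt_ab|eq_ab] := ltngtP b1 a1; rewrite //= lt_neqAle.
rewrite /val_gt /val_ge; split=> -[Rf [f0|[b fb ab]]]; split; try exact: Rf.
- by left.
- by right; exists b; rewrite -?ltE.
- by left.
- by right; exists b; rewrite ?ltE.
Qed.

Lemma val_geB f f' a :
  val_ge g p a f -> val_ge g p a f' -> val_ge g p a (f - f').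
Proof.
move=> /val_geP[Rf f0 f_ord] /val_geP[Rf' f0' f_ord']; apply/val_geP; split.
- exact: section_ringB.
- by move=> i lt_i; rewrite coefB f0 // f0' // subr0.
by rewrite coefB mulrBl; exact: (order_geB V).
Qed.

Lemma val_ge0 a : val_ge g p a 0.
Proof. by split; [exact: section_ring0 | left]. Qed.

Lemma has_val_cst c : c != 0 -> has_val g p (cst I c)%:P 0.
Proof.
move=> nz_c; have nz_cst : cst I c != 0 by rewrite fmorph_eq0.
apply/(has_valP _ (section_ringC c)); rewrite polyC_eq0.
split; [exact: nz_cst | by rewrite size_polyC nz_cst |].
have c_unit : local_unit p (cst I c).
  split; [exact: nz_cst | exact: local_ring_cst |].
  by rewrite -fmorphV; exact: local_ring_cst.
rewrite /lead_order lead_coefC size_polyC nz_cst expr0 divr1.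
exact: (local_unit_ord0 p u _).1 c_unit.
Qed.

Lemma has_valM f f' a a' : section_ring g f -> section_ring g f' ->
  has_val g p f a -> has_val g p f' a' -> has_val g p (f * f') (a + a').
Proof.
move=> Rf Rf' /(has_valP _ Rf)[nz_f a1 f_ord].
move=> /(has_valP _ Rf')[nz_f' a1' f_ord'].
have nz_ff' : f * f' != 0 := mulf_neq0 nz_f nz_f'.
have degE : (size (f * f')).-1 = ((size f).-1 + (size f').-1)%N.
  rewrite size_mul //; move: nz_f nz_f'; rewrite -!size_poly_eq0.
  by case: (size f) (size f') => [|m] [|m'] //= _ _; rewrite addnS.
apply/(has_valP _ (section_ringM Rf Rf')).
split; [exact: nz_ff' | by rewrite degE -a1 -a1' |].
rewrite /lead_order lead_coefM degE exprD -mulf_div.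
exact: (order_isM V f_ord f_ord').
Qed.

Lemma leading_residue a b j : ord_is a j -> ord_is b j ->
  exists c, ord_ge (j + 1) (cst I c * b - a).
Proof.
move=> a_ord b_ord; have [nz_b Ob OVb] := b_ord; have [nz_a Oa _] := a_ord.
have [c /(local_idealE X_curve p_on u_unif) mc] :=
  local_value p_on (local_ringM Oa OVb).
by exists c; exact: (order_ge_residue V b_ord mc).
Qed.

(** The value of a section is that of one of its homogeneous components. *)
Lemma value_semigroupP a : value_semigroup g p a <-> exists2 s,
  global_section (tensor_power g a.1) s & ord_is (s / g p ^+ a.1) a.2.
Proof.
split=> [[f [Rf nz_f /(has_valP _ Rf)[_ a1 f_ord]]]|[s Rs s_ord]].
  by exists (lead_coef f); rewrite a1 //; exact: Rf.
have nz_s : s != 0.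
  by apply: contraNneq (order_is_neq0 s_ord) => ->; rewrite mul0r.
pose f := s *: 'X^(a.1); have nz_f : f != 0.
  by rewrite -lead_coef_eq0 lead_coefZ lead_coefXn mulr1; exact: nz_s.
have Rf : section_ring g f.
  move=> i; rewrite coefZ coefXn; case: eqP => [->|_]; first by rewrite mulr1.
  by rewrite mulr0; exact: global_section0.
exists f; split; [exact: Rf | exact: nz_f | apply/(has_valP _ Rf)].
have sizef : (size f).-1 = a.1 by rewrite (size_scale _ nz_s) size_polyXn.
split; [exact: nz_f | by rewrite sizef |].
by rewrite /lead_order sizef lead_coefZ lead_coefXn mulr1.
Qed.

Section Generation.
Variable gs : seq (nat * int).
Hypothesis gs_generate : forall a, value_semigroup g p a -> combination gs a.
Variable b : nat * int -> {poly K}.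
Hypothesis b_section : forall e, e \in gs -> section_ring g (b e).
Hypothesis b_val : forall e, e \in gs -> has_val g p (b e) e.

Local Notation generated := (gr_subalgebra g p (fun f => f \in map b gs)).

Let gr_one : generated [:: (0, 1)].
Proof. by have := GrConst g p (fun f => f \in map b gs) 1; rewrite rmorph1. Qed.

Let gr_mul_single a a' f f' :
  generated [:: (a, f)] -> generated [:: (a', f')] ->
  generated [:: (a + a', f * f')].
Proof. exact: GrMul. Qed.

(** The class of f is a homogeneous element of degree a of the subalgebra
    generated by the images of the b e. *)
Definition realizes a f : Prop :=
  [/\ section_ring g f, has_val g p f a & generated [:: (a, f)]].

Lemma realizes1 : realizes 0 1.
Proof.
split; last exact: gr_one.
  by have := section_ringC 1; rewrite rmorph1.
by have := has_val_cst (oner_neq0 k); rewrite rmorph1.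
Qed.

Lemma realizesM a a' f f' :
  realizes a f -> realizes a' f' -> realizes (a + a') (f * f').
Proof.
move=> [Rf fa genf] [Rf' fa' genf']; split.
- exact: section_ringM.
- exact: has_valM.
- exact: gr_mul_single.
Qed.

(** Monomials in the b e realize all combinations of their values. *)
Lemma combination_realized a : combination gs a -> exists f, realizes a f.
Proof.
move=> [c ->]; have : {subset gs <= gs} by [].
elim: {1 3}gs => [|e s IHs] sub_s.
  by rewrite big_nil; exists 1; exact: realizes1.
have [|f rf] := IHs; first by move=> e' se'; apply: sub_s; rewrite inE se' orbT.
have gs_e : e \in gs by apply: sub_s; rewrite mem_head.
have re : realizes e (b e).
  split; [exact: b_section | exact: b_val |].
  by apply: GrImage (b_val gs_e); exact: map_f.
rewrite big_cons; elim: (c e) => [|i [f' rf']].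
  by exists f; rewrite mulr0n add0r.
by exists (b e * f'); rewrite mulrS -addrA; exact: realizesM.
Qed.

Lemma gr_eq_single a f f' :
  val_gt g p a (f - f') -> gr_eq g p [:: (a, f)] [:: (a, f')].
Proof.
move=> ff' a'; rewrite /gr_comp !big_cons !big_nil /=.
case: eqP => [<-|_]; first by rewrite !addr0.
by rewrite subr0; apply/val_gtP; exact: val_ge0.
Qed.

(** Either f vanishes in degree a, or it has value a; then some f' with the same
    value is a monomial in the generators, and f is congruent to a scalar
    multiple of f' modulo elements of higher value. *)
Lemma single_generated a f : val_ge g p a f -> generated [:: (a, f)].
Proof.
move=> fa; have wf : gr_wf g p [:: (a, f)] by move=> af; rewrite inE => /eqP->.
have [Rf f0 f_ge] := (val_geP f a).1 fa.
have [f_gt|f_ngt] := pselect (ord_ge (a.2 + 1) (f`_a.1 / g p ^+ a.1)).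
  apply: (GrEq (GrConst g p _ 0) wf) => a'.
  rewrite /gr_comp !big_cons !big_nil /= rmorph0 !addr0 if_same; apply/val_gtP.
  apply: val_geB; first exact: val_ge0.
  case: eqP => [<-|_]; last exact: val_ge0.
  by apply/val_geP; split.
have f_ord : ord_is (f`_a.1 / g p ^+ a.1) a.2 by apply/(order_isP V).
have [f' [Rf' /(has_valP _ Rf')[nz_f' a1 f_ord'] gen_f']] :
  exists f', realizes a f'.
  apply/combination_realized/gs_generate/value_semigroupP.
  by exists f`_a.1; first exact: Rf.
have [c c_res] := leading_residue f_ord f_ord'.
have gen_cf' : generated [:: (a, (cst I c)%:P * f')].
  by rewrite -[a]add0r; apply: gr_mul_single gen_f'; exact: GrConst.
apply: (GrEq gen_cf' wf); apply: gr_eq_single; apply/val_gtP/val_geP; split.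
- apply: section_ringB Rf; apply: section_ringM Rf'; exact: section_ringC.
- move=> i lt_ai; rewrite coefB coefCM (f0 i lt_ai) subr0 nth_default ?mulr0 //.
  by move: lt_ai; rewrite a1; case: (size f').
- move: c_res; rewrite lead_coefE -a1 coefB coefCM mulrA -mulrBl.
  exact.
Qed.

Theorem khovanskii_basis_of_generators :
  khovanskii_basis g p (fun f => f \in map b gs).
Proof.
split=> [_ /mapP[e gs_e ->]|]; first exact: b_section.
elim=> [|[a f] h IHh] wf.
  apply: (GrEq (GrConst g p _ 0)) => // a.
  rewrite /gr_comp big_cons !big_nil /=.
  by rewrite rmorph0 addr0 if_same subr0; apply/val_gtP; exact: val_ge0.
apply: (GrAdd (h := [:: (a, f)])).
  by apply: single_generated; exact: (wf (a, f) (mem_head _ _)).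
by apply: IHh => af h_af; apply: wf; rewrite inE h_af orbT.
Qed.

End Generation.
End SectionRing.

(* X = V(I) in P^n, and L is the line bundle with local generators g. *)
Theorem proposition3p1 (k : closedFieldType) (char0 : [pchar k] =i pred0)
    (n : nat) (I : prime_idealr {mpoly k[n.+1]})
    (X_curve : projective_curve I)
    (g : 'rV[k]_n.+1 -> {fraction (coord_ring I)})
    (L_line_bundle : line_bundle g) (L_very_ample : very_ample g)
    (p : 'rV[k]_n.+1) (p_smooth : smooth_point I p)
    (L_multiple_p : class_multiple_of_point g p) :
  (exists B : seq {poly {fraction (coord_ring I)}},
     khovanskii_basis g p (fun b => b \in B)) /\
  finitely_generated (value_semigroup g p).

Proof.
have [p_on [u u_unif]] := p_smooth; have g_ff := L_line_bundle.1.
have [d [h [h_Op [phi [nz_phi phi_ff phi_iso]]]]] := L_multiple_p.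
have semigroupE a : value_semigroup g p a <->
    0 <= a.2 /\ pole_order p u (d * a.1%:Z - a.2).
  split=> [|[a2 pole_a]].
    move=> /(value_semigroupP X_curve p_on u_unif g_ff)[s Rs s_ord].
    exact: (section_pole_order X_curve p_on u_unif g_ff h_Op phi_ff phi_iso Rs).
  apply/(value_semigroupP X_curve p_on u_unif g_ff).
  exact: (pole_order_section X_curve p_on u_unif h_Op phi_ff phi_iso).
have [gs [gsT gsE]] := section_semigroup_generated d
  (pole_order0 p_on u) (@pole_orderD _ _ _ X_curve _ p_on _ u_unif)
  (@pole_order_ge0 _ _ _ X_curve _ p_on _ u_unif).
have /choice[b bP] (e : nat * int) : exists f, e \in gs ->
    section_ring g f /\ has_val g p f e.
  have [/gsT/semigroupE[f [Rf _ fe]]|_] := boolP (e \in gs); first by exists f.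
  by exists 0.
split; last by exists gs => a; rewrite semigroupE gsE.
exists (map b gs).
apply: (khovanskii_basis_of_generators X_curve p_on u_unif g_ff).
- by move=> a /semigroupE/gsE.
- by move=> e /bP[].
- by move=> e /bP[].
Qed.
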